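(* Let $n\geq 2$ be an integer. Then the following three (equivalent) inequalities hold. (i) $$2^{n-1}\Delta_{n-1}\sum_{k=1}^{\lfloor 2\Delta_nV_{n-1}/(\Delta_{n-1}V_n)\rfloor}\left(\sum_{l\mid k}\frac{\mu(l)}{l^{n-1}}\right)\left(1-\left(\frac{k\Delta_{n-1}V_n}{2\Delta_nV_{n-1}}\right)^2\right)^{(n-1)/2}\geq 1.$$ (ii) $$2^{n-1}\delta_{n-1}\frac{\pi^{(n-1)/2}}{((n-1)/2)!}\sum_{k=1}^{\lfloor 2\delta_n/\delta_{n-1}\rfloor}\left(\sum_{l\mid k}\frac{\mu(l)}{l^{n-1}}\right)\left(1-\left(\frac{k\delta_{n-1}}{2\delta_n}\right)^2\right)^{(n-1)/2}\geq 1.$$ (iii) $$\frac{\pi^{(n-1)/2}}{((n-1)/2)!}\sum_{k=1}^{\lfloor \gamma_n^{n/2}/\gamma_{n-1}^{(n-1)/2}\rfloor}\left(\sum_{l\mid k}\frac{\mu(l)}{l^{n-1}}\right)\left(\gamma_{n-1}-k^2\left(\frac{\gamma_{n-1}}{\gamma_n}\right)^n\right)^{(n-1)/2}\geq 1.$$ Here the inner sums $\sum_{l\mid k}$ run over all positive integer divisors $l$ of $k$.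
   Context: For a lattice $\Lambda$ (discrete cocompact subgroup) in $m$-dimensional Euclidean space $\mathbf{E}^m$, $\min\Lambda=\min_{\lambda\in\Lambda\setminus\{0\}}\langle\lambda,\lambda\rangle$ is the squared length of a shortest nonzero vector and $\det\Lambda$ is the determinant of a Gram matrix of $\Lambda$. The density is $\Delta(\Lambda)=\sqrt{(\min\Lambda)^m/(4^m\det\Lambda)}\,V_m$, where $V_m=\pi^{m/2}/(m/2)!$ is the volume of the unit ball in $\mathbf{E}^m$ (with $x!=\Gamma(x+1)$). $\Delta_m$ denotes the maximal density of $m$-dimensional lattices, $\delta_m=\Delta_m/V_m$ the maximal center density, and $\gamma_m=4\delta_m^{2/m}$ the Hermite constant. $\mu$ denotes the Möbius function: $\mu(l)=(-1)^a$ if $l$ is a product of $a$ distinct primes and $\mu(l)=0$ if $l$ is divisible by the square of a prime. *)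

(* Defs.v *)
From mathcomp Require Import all_boot all_order all_algebra.
From mathcomp Require Import all_classical all_reals all_analysis.

Set Implicit Arguments.
Unset Strict Implicit.
Unset Printing Implicit Defensive.

Import Order.TTheory GRing.Theory Num.Theory.
Import numFieldNormedType.Exports.

Local Open Scope classical_set_scope.
Local Open Scope ring_scope.

(* Only used for 0 < l. *)
Definition mobius (l : nat) : int :=
  if has (fun p => (p ^ 2 %| l)%N) (primes l) then 0
  else (-1) ^+ size (primes l).

Section Lattices.
Variable R : realType.

Definition gamma_fun (x : R) : R :=
  \int[lebesgue_measure]_(t in `]0, +oo[) (t `^ (x - 1) * expR (- t)).

Definition real_fact (x : R) : R := gamma_fun (x + 1).

Definition ball_vol (m : nat) : R :=
  pi `^ (m%:R / 2) / real_fact (m%:R / 2).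

Definition dotv (m : nat) (u v : 'rV[R]_m) : R := \sum_i u 0 i * v 0 i.

(* The topology on 'rV[R]_m is the library's sup-norm one, which is also the
   Euclidean topology.  The last clause says that the quotient by L is compact:
   some compact K meets every coset of L. *)
Definition is_lattice (m : nat) (L : set 'rV[R]_m) : Prop :=
  [/\ L 0,
      forall x y, L x -> L y -> L (x - y),
      L `<=` isolated L
    & exists2 K : set 'rV[R]_m, compact K &
        forall x, exists2 l, L l & K (x - l)].

(* The infimum is attained when L is a lattice and 0 < m. *)
Definition lattice_min (m : nat) (L : set 'rV[R]_m) : R :=
  inf [set dotv v v | v in L `\ 0].

(* The rows of B form a Z-basis of L. *)
Definition lattice_basis (m : nat) (L : set 'rV[R]_m) (B : 'M[R]_m) : Prop :=
  row_free B /\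
  L = [set map_mx intr z *m B | z in [set: 'rV[int]_m]].

Definition gram (m : nat) (B : 'M[R]_m) : 'M[R]_m :=
  \matrix_(i, j) dotv (row i B) (row j B).

(* Every lattice has a Z-basis and the determinant of its Gram matrix does not
   depend on the basis, so the default value 0 is never used for a lattice. *)
Definition lattice_det (m : nat) (L : set 'rV[R]_m) : R :=
  xget 0 [set \det (gram B) | B in lattice_basis L].

Definition lattice_density (m : nat) (L : set 'rV[R]_m) : R :=
  Num.sqrt (lattice_min L ^+ m / (4 ^+ m * lattice_det L)) * ball_vol m.

(* The supremum is finite and, by Mahler compactness, attained for 0 < m. *)
Definition max_density (m : nat) : R :=
  sup [set lattice_density L | L in @is_lattice m].

Definition center_density (m : nat) : R := max_density m / ball_vol m.

Definition hermite_const (m : nat) : R :=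
  4 * center_density m `^ (2 / m%:R).

End Lattices.

(* Main.v *)
(* Fix a lattice L of rank m = n - 1 whose density is close to the maximum and
   let B be a basis of it.  For v in R^m and h > 0 consider the rank n lattice of
   all (k h, (k v + z) B) with k an integer and z an integer vector.  If h is just
   small enough for the maximal density in dimension n to force, for every v, a
   nonzero vector of squared length less than M = min L into this lattice, then
   that vector has k <> 0, and the one with the least k > 0 has (k, z) free of
   common prime divisors.  So the torus R^m / Z^m is covered by the sets of those v
   for which a given k and a given class of z modulo k, coprime to k, do the job.
   The proportion of such classes is the sum of mu(l) / l^m over l | k, and together
   they cover at most that multiple of vol {u : |u B|^2 <= M - k^2 h^2}.  These
   volumes add up to at least 1; letting the density of L tend to the maximum and h to its critical
   value gives the inequality.

   The ball volume formula comes from integrating exp(- Q) for a positive definite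
   quadratic form Q in two ways: by completing squares, and by layers Q <= s. *)
From HB Require Import structures.
Require Import Defs.
From mathcomp Require Import all_boot all_order all_algebra.
From mathcomp Require Import all_classical all_reals all_analysis.
From mathcomp Require Import measurable_realfun.
From mathcomp Require Import ring lra.

Import Order.TTheory GRing.Theory Num.Theory.
Import numFieldNormedType.Exports.
Local Open Scope classical_set_scope.
Local Open Scope ring_scope.

Set Implicit Arguments.
Unset Strict Implicit.
Unset Printing Implicit Defensive.

(** * Iterated Lebesgue measure *)

Section affine_line.
Context {R : realType}.
Notation leb := (@lebesgue_measure R).

Definition aff1 (c b : R) (x : measurableTypeR R) : measurableTypeR R := c * x + b.

Lemma measurable_aff1 (c b : R) : measurable_fun setT (aff1 c b).
Proof. by apply: measurable_funD => //; exact: measurable_funM. Qed.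

Definition image_aff1 (c b : R) : measure (measurableTypeR R) R :=
  measure_function_pushforward__canonical__measure_function_Measure leb (measurable_aff1 c b).

Lemma preimage_aff1_itvoc (c b x y : R) : 0 < c ->
  aff1 c b @^-1` `]x, y] = `](x - b) / c, (y - b) / c]%classic.
Proof.
move=> c0; apply/seteqP; split => t /=; rewrite !in_itv /= /aff1.
  by rewrite ltr_pdivrMr// ler_pdivlMr// ltrBlDr lerBrDr mulrC.
by rewrite ltr_pdivrMr// ler_pdivlMr// ltrBlDr lerBrDr mulrC.
Qed.

Local Open Scope ereal_scope.

(** The right-hand side is itself a measure in [A] and agrees with length on half-open intervals, so
    uniqueness of Lebesgue measure applies. *)
Lemma lebesgue_measure_aff1 (c b : R) (A : set (measurableTypeR R)) : (0 < c)%R ->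
  measurable A -> leb A = c%:E * leb (aff1 c b @^-1` A).
Proof.
move=> c0 mA.
rewrite (lebesgue_measure_unique (mu := mscale (NngNum (ltW c0)) (image_aff1 c b))) //.
move=> _ [[x y] _ <-] /=.
rewrite /mscale /= /pushforward preimage_aff1_itvoc// !lebesgue_measure_itv/=.
rewrite !lte_fin ltr_pM2r ?invr_gt0// ltrD2r.
case: ifPn => _; last by rewrite mule0.
by rewrite -!EFinB -EFinM; congr EFin; field; rewrite gt_eqF.
Qed.

Lemma integral_aff1 (c b : R) (f : R -> \bar R) : (0 < c)%R ->
  measurable_fun setT f -> (forall x, 0 <= f x) ->
  \int[leb]_x f x = c%:E * \int[leb]_x f (c * x + b)%R.
Proof.
move=> c0 mfun f0.
transitivity (\int[mscale (NngNum (ltW c0)) (image_aff1 c b)]_x f x).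
  by apply: eq_measure_integral => A mA _; exact: lebesgue_measure_aff1.
rewrite ge0_integral_mscale//; congr (_ * _).
by rewrite ge0_integral_pushforward//; exact: measurable_aff1.
Qed.

End affine_line.

Section euclid.
Context {R : realType}.
Notation leb := (@lebesgue_measure R).

(* The display of an iterated product depends on the number of factors, so the
   recursion must carry the display, the space and the measure together. *)
Record mspace := MSpace {
  ms_disp : measure_display ;
  ms_sort : measurableType ms_disp ;
  ms_measure : {sigma_finite_measure set ms_sort -> \bar R} }.

Definition line_prod (M : mspace) : set (measurableTypeR R * ms_sort M)%type -> \bar R :=
  (leb \x ms_measure M)%E.
Arguments line_prod : clear implicits.

HB.instance Definition _ M := Measure.on (line_prod M).

Lemma line_prod_sigma_finite M : sigma_finite setT (line_prod M).
Proof.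
have /sigma_finiteP[F [TF ndF Foo]] := sigma_finiteT leb.
have /sigma_finiteP[G [TG ndG Goo]] := sigma_finiteT (ms_measure M).
exists (fun n => F n `*` G n); last first.
  move=> n; have [mF Fn] := Foo n; have [mG Gn] := Goo n; split.
    exact: measurableX.
  by rewrite /line_prod product_measure1E// lte_mul_pinfty// ge0_fin_numE.
apply/seteqP; split => // -[x y] _.
have [i _ Fx] : (\bigcup_i F i) x by rewrite -TF.
have [j _ Gy] : (\bigcup_i G i) y by rewrite -TG.
exists (maxn i j) => //; split => /=.
  by move: x Fx; exact/subsetPset/ndF/leq_maxl.
by move: y Gy; exact/subsetPset/ndG/leq_maxr.
Qed.

HB.instance Definition _ M := Measure_isSigmaFinite.Build _ _ _ (line_prod M)
  (@line_prod_sigma_finite M).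

Fixpoint espace (m : nat) : mspace :=
  if m is m'.+1 then MSpace (line_prod (espace m')) else MSpace (dirac tt).

Definition euclid m := ms_sort (espace m).
Definition vol m : {sigma_finite_measure set (euclid m) -> \bar R} := @ms_measure (espace m).

(** The iterated product carries the measure, row vectors carry the linear algebra; [toV] and [ofV]
    translate between the two. *)
Fixpoint toV (m : nat) : euclid m -> 'rV[R]_m :=
  if m is m'.+1 then fun y => row_mx (y.1)%:M (toV y.2) : 'rV[R]_(1 + m')
  else fun _ => 0.

Fixpoint ofV (m : nat) : 'rV[R]_m -> euclid m :=
  if m is m'.+1 then fun v : 'rV[R]_(1 + m') => (v 0 0, ofV (rsubmx v))
  else fun _ => tt.

Lemma toVK m : cancel (@toV m) (@ofV m).
Proof.
elim: m => [[]//|m IH] [x y] /=.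
by rewrite row_mxKr IH mxE split1 /= unlift_none /= mxE.
Qed.

Lemma ofVK m : cancel (@ofV m) (@toV m).
Proof.
elim: m => [v|m IH v] /=; first by apply/rowP => -[].
rewrite IH (_ : (v 0 0)%:M = lsubmx (v : 'rV[R]_(1 + m))) ?hsubmxK//.
apply/rowP => i; rewrite !ord1 !mxE /= mulr1n; congr (v _ _); exact/val_inj.
Qed.

Lemma measurable_coord m i : measurable_fun setT (fun y : euclid m => toV y 0 i).
Proof.
elim: m i => [[]//|m IH] i /=.
have [j ->|->] := unliftP ord0 i; last first.
  rewrite (_ : (fun _ => _) = fst)//; apply/funext => -[x y] /=.
  by rewrite mxE split1 unlift_none /= mxE.
rewrite (_ : (fun _ => _) = (fun y => toV y 0 j) \o snd); last first.
  by apply/funext => -[x y] /=; rewrite mxE split1 liftK /=.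
by apply: measurableT_comp => //; exact: IH.
Qed.

Lemma measurable_to_euclid d (T : measurableType d) m (f : T -> euclid m) :
  (forall i, measurable_fun setT (fun t => toV (f t) 0 i)) -> measurable_fun setT f.
Proof.
elim: m f => [|m IH] f mf.
  by rewrite (_ : f = fun=> tt)//; apply/funext => t; case: (f t).
apply/measurable_fun_pairP; split.
  have := mf 0; congr measurable_fun; apply/funext => t /=.
  by rewrite mxE split1 unlift_none /= mxE.
apply: IH => i; have := mf (lift ord0 i); congr measurable_fun; apply/funext => t /=.
by rewrite mxE split1 liftK.
Qed.

Definition aff m (c : R) (v : 'rV[R]_m) (y : euclid m) : euclid m :=
  ofV (c *: toV y + v).

Lemma measurable_aff m c v : measurable_fun setT (@aff m c v).
Proof.
apply: measurable_to_euclid => i; rewrite /aff.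
under eq_fun do rewrite ofVK !mxE.
apply: measurable_funD => //; apply: measurable_funM => //; exact: measurable_coord.
Qed.

(** Slice along the first coordinate: each section of the preimage is an affine preimage in one
    dimension less, and substitution in the first variable supplies one more factor [c]. *)
Lemma vol_aff m c v (A : set (euclid m)) : 0 < c -> measurable A ->
  vol m A = ((c ^+ m)%:E * vol m (aff c v @^-1` A))%E.
Proof.
move=> c0; elim: m v A => [|m IH] v A mA.
  rewrite expr0 mul1e; congr (vol 0 _); apply/seteqP; split => -[] //=;
  by rewrite /aff; case: ofV.
have affE : aff c v = fun y : euclid m.+1 =>
    (c * y.1 + v 0 0, aff c (rsubmx (v : 'rV[R]_(1 + m))) y.2).
  apply/funext => -[x y]; rewrite /aff /= !mxE split1 unlift_none /= mxE mulr1n; congr pair.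
  congr ofV; rewrite linearD /= linearZ /=; congr (_ *: _ + _).
  by rewrite row_mxKr.
have volE B : vol m.+1 B = (\int[leb]_x vol m (xsection B x))%E by [].
rewrite !volE (integral_aff1 (v 0 0) c0); last 2 first.
- exact: measurable_fun_xsection.
- by move=> x; exact: measure_ge0.
rewrite exprS EFinM -muleA; congr (_ * _)%E.
rewrite -ge0_integralZl//; last 2 first.
- apply: measurable_fun_xsection.
  rewrite -[_ @^-1` _]setTI; exact: (measurable_aff c v).
- by rewrite lee_fin exprn_ge0// ltW.
apply: eq_integral => x _ /=.
rewrite (IH (rsubmx (v : 'rV[R]_(1 + m)))); last exact: measurable_xsection.
congr (_ * vol m _)%E; apply/seteqP; split => y; rewrite /xsection /= !inE affE.
  by [].
by [].
Qed.

End euclid.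

(** * Gaussian integrals *)

Section quadratic_forms.
Context {R : realType}.
Notation leb := (@lebesgue_measure R).

Definition quad m (G : 'M[R]_m) (v : 'rV[R]_m) : R := (v *m G *m v^T) 0 0.

Definition posdef m (G : 'M[R]_m) := G^T = G /\ forall v, v != 0 -> 0 < quad G v.

Lemma quad0 m (G : 'M[R]_m) : quad G 0 = 0.
Proof. by rewrite /quad !mul0mx mxE. Qed.

Lemma quad_ge0 m (G : 'M[R]_m) v : posdef G -> 0 <= quad G v.
Proof. by move=> [_ /(_ v) h]; have [->|/h/ltW//] := eqVneq v 0; rewrite quad0. Qed.

Lemma quadZ m (G : 'M[R]_m) c v : quad G (c *: v) = c ^+ 2 * quad G v.
Proof.
by rewrite /quad linearZ /= -scalemxAl -scalemxAl -scalemxAr scalerA mxE expr2.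
Qed.

Definition schur m (a : R) (b : 'rV[R]_m) (C : 'M[R]_m) : 'M[R]_m := C - a^-1 *: (b^T *m b).

(** Completing the square in the first variable; the Schur complement is the form that remains. *)
Lemma quad_block m a (b : 'rV[R]_m) (C : 'M[R]_m) x (v : 'rV[R]_m) : a != 0 ->
  quad (block_mx a%:M b b^T C : 'M[R]_(1 + m)) (row_mx x%:M v) =
  a * (x + (v *m b^T) 0 0 / a) ^+ 2 + quad (schur a b C) v.
Proof.
move=> a0; rewrite /quad /schur tr_row_mx mul_row_block mul_row_col !mulmxDl mulmxBr mulmxBl.
rewrite -!scalemxAr -!scalemxAl !mulmxA -(mulmxA (v *m b^T)).
have bv : b *m v^T = (v *m b^T)^T by rewrite trmx_mul trmxK.
rewrite -(mulmxA x%:M b) bv; set d := v *m b^T; set q := v *m C *m v^T.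
rewrite (mx11_scalar d) !tr_scalar_mx -!scalar_mxM !mxE !eqxx !mulr1n.
set s1 := \sum_j _ * b^T j 0; set s2 := \sum_j _ * v^T j 0.
by field.
Qed.

Lemma det_block m a (b : 'rV[R]_m) (C : 'M[R]_m) : a != 0 ->
  \det (block_mx a%:M b b^T C : 'M[R]_(1 + m)) = a * \det (schur a b C).
Proof.
move=> a0.
have -> : block_mx a%:M b b^T C =
    block_mx 1%:M 0 (a^-1 *: b^T) 1%:M *m block_mx a%:M b 0 (schur a b C) :> 'M[R]_(1 + m).
  rewrite mulmx_block !mul1mx !mul0mx !addr0 -scalemxAl mul_mx_scalar.
  rewrite scalerA mulVf// scale1r; congr block_mx.
  by rewrite /schur -scalemxAl addrCA subrr addr0.
by rewrite det_mulmx det_lblock det_ublock !det1 !mul1r det_scalar1.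
Qed.

Lemma sym_block m (G : 'M[R]_(1 + m)) : G^T = G ->
  G = block_mx (G 0 0)%:M (ursubmx G) (ursubmx G)^T (drsubmx G).
Proof.
move=> sG; rewrite -[LHS]submxK; congr block_mx.
  by rewrite [LHS]mx11_scalar; congr _%:M; rewrite !mxE; congr (G _ _); exact: val_inj.
by rewrite -[in LHS]sG trmx_ursub.
Qed.

Lemma measurable_quad m (G : 'M[R]_m) : measurable_fun setT (fun y : euclid m => quad G (toV y)).
Proof.
have -> : (fun y : euclid m => quad G (toV y)) =
   (fun y => \sum_i (\sum_j toV y 0 j * G j i) * toV y 0 i).
  by apply/funext => y; rewrite /quad mxE; apply: eq_bigr => i _; rewrite !mxE.
apply: measurable_sum => i; apply: measurable_funM; last exact: measurable_coord.
by apply: measurable_sum => j; apply: measurable_funM => //; exact: measurable_coord.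
Qed.

Lemma integral_gauss_line (a e q : R) : 0 < a ->
  (\int[leb]_x (expR (- (a * (x + e) ^+ 2 + q)))%:E =
   (Num.sqrt pi / Num.sqrt a * expR (- q))%:E)%E.
Proof.
move=> a0; have sa0 : 0 < Num.sqrt a by rewrite sqrtr_gt0.
pose g (x : R) : R := gauss_fun x.
have mg : measurable_fun setT (EFin \o g).
  by apply/measurable_EFinP; exact: measurable_gauss_fun.
have g0 x : (0 <= (EFin \o g) x)%E by rewrite lee_fin expR_ge0.
have := integralT_gauss (R := R).
rewrite -[X in X = _]/(\int[leb]_x (EFin \o g) x)%E.
rewrite (integral_aff1 (Num.sqrt a * e) sa0 mg g0) => gE.
transitivity (\int[leb]_x ((expR (- q))%:E * (EFin \o g) (Num.sqrt a * x + Num.sqrt a * e)%R))%E.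
  apply: eq_integral => x _ /=; rewrite -EFinM -expRD; congr (expR _)%:E.
  by rewrite -mulrDr exprMn sqr_sqrtr 1?ltW// opprD addrC.
rewrite ge0_integralZl//; last first.
  by apply: (measurableT_comp mg); exact: measurable_aff1.
have -> : (\int[leb]_x (EFin \o g) (Num.sqrt a * x + Num.sqrt a * e)%R =
           (Num.sqrt a)^-1%:E * (Num.sqrt pi)%:E)%E.
  by rewrite -gE muleA -EFinM mulVf ?gt_eqF// mul1e.
by rewrite -!EFinM; congr EFin; ring.
Qed.

(** Induction on the dimension by Tonelli: after completing the square, the inner integral is a
    shifted one-dimensional Gaussian, and the Schur complement goes to the induction hypothesis.
    Positivity of the determinant is carried along to split the square root of a product. *)
Lemma integral_gauss m (G : 'M[R]_m) : posdef G ->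
  0 < \det G /\
  (\int[vol m]_y (expR (- quad G (toV y)))%:E =
   (Num.sqrt pi ^+ m / Num.sqrt (\det G))%:E)%E.
Proof.
elim: m G => [|m IH] G [sG pG].
  rewrite det_mx00 ltr01 sqrtr1 expr0 divr1; split=> //.
  rewrite integral_dirac// ?diracT ?mul1e /= ?quad0 ?oppr0 ?expR0//.
have GE := sym_block (sG : (G : 'M[R]_(1 + m))^T = G).
set a := G 0 0 in GE; set b := ursubmx _ in GE; set C := drsubmx _ in GE.
have pos x (v : 'rV[R]_m) : (x != 0) || (v != 0) ->
    0 < quad (block_mx a%:M b b^T C : 'M[R]_(1 + m)) (row_mx x%:M v).
  move=> xv; rewrite -GE; apply: pG; apply: contraTN xv => /eqP e.
  have := congr1 (fun w : 'rV[R]_(1 + m) => rsubmx w) e; rewrite /= row_mxKr linear0 => ->.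
  have := congr1 (fun w : 'rV[R]_(1 + m) => lsubmx w 0 0) e.
  by rewrite /= row_mxKl linear0 !mxE eqxx mulr1n => ->; rewrite !eqxx.
have a0 : 0 < a.
  have := pos 1 0; rewrite oner_eq0 => /(_ isT).
  rewrite /quad tr_row_mx mul_row_block mul_row_col trmx0 mulmx0 addr0.
  by rewrite !mul0mx addr0 -!scalar_mxM tr_scalar_mx -scalar_mxM !mxE eqxx mulr1n mul1r mulr1.
have an0 : a != 0 by rewrite gt_eqF.
have pS : posdef (schur a b C).
  split.
    rewrite /schur linearB /= linearZ /= trmx_mul trmxK; congr (_ - _).
    by rewrite /C trmx_drsub sG.
  (* This first coordinate makes the completed square vanish, so the Schur complement inherits
     positivity. *)
  move=> v v0; have := pos (- ((v *m b^T) 0 0 / a)) v.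
  by rewrite v0 orbT => /(_ isT); rewrite quad_block// addNr expr0n mulr0 add0r.
have [dS IS] := IH _ pS.
have detG : \det G = a * \det (schur a b C) by rewrite [in LHS]GE det_block.
split; first by rewrite detG mulr_gt0.
pose f (y : euclid m.+1) : \bar R := (expR (- quad G (toV y)))%:E.
have mf : measurable_fun setT f.
  apply/measurable_EFinP; apply: measurableT_comp => //.
  by apply: measurableT_comp => //; exact: measurable_quad.
transitivity (\int[vol m]_y \int[leb]_x f (x, y))%E.
  apply: (fubini_tonelli2 (m1 := leb) (m2 := vol m) f) => // y.
  by rewrite lee_fin expR_ge0.
transitivity (\int[vol m]_y ((Num.sqrt pi / Num.sqrt a)%:E *
                             (expR (- quad (schur a b C) (toV y)))%:E))%E.
  apply: eq_integral => y _; rewrite -EFinM -(integral_gauss_line ((toV y *m b^T) 0 0 / a) _ a0).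
  by apply: eq_integral => x _; rewrite /f /= [in LHS]GE quad_block.
rewrite ge0_integralZl ?lee_fin ?divr_ge0 ?sqrtr_ge0//; last first.
  apply/measurable_EFinP; apply: measurableT_comp => //.
  by apply: measurableT_comp => //; exact: measurable_quad.
rewrite IS -EFinM; congr EFin; rewrite detG sqrtrM 1?ltW// invfM exprS; ring.
Qed.

End quadratic_forms.

(** * Volume of ellipsoids *)

Section ellipsoid_volume.
Context {R : realType}.
Notation leb := (@lebesgue_measure R).

Lemma powR_half (x : R) m : 0 <= x -> x `^ (m%:R / 2) = Num.sqrt x ^+ m.
Proof.
by move=> x0; rewrite mulrC powRrM powR12_sqrt// powR_mulrn// sqrtr_ge0.
Qed.

Definition ellipsoid m (G : 'M[R]_m) (s : R) : set (euclid m) := [set y | quad G (toV y) <= s].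

Lemma measurable_ellipsoid m (G : 'M[R]_m) s : measurable (ellipsoid G s).
Proof.
rewrite (_ : ellipsoid G s = setT `&` (fun y => quad G (toV y)) @^-1` `]-oo, s]%classic).
  exact: measurable_quad.
by rewrite setTI; apply/seteqP; split => y /=; rewrite in_itv.
Qed.

Lemma vol_ellipsoid_scale m (G : 'M[R]_m) s : 0 < s ->
  (vol m (ellipsoid G s) = (s `^ (m%:R / 2))%:E * vol m (ellipsoid G 1))%E.
Proof.
move=> s0; have ss0 : 0 < Num.sqrt s by rewrite sqrtr_gt0.
rewrite (vol_aff 0 ss0); last exact: measurable_ellipsoid.
rewrite powR_half ?ltW//; congr (_ * vol m _)%E; apply/seteqP.
have E y : quad G (toV (aff (Num.sqrt s) 0 y)) = s * quad G (toV y).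
  by rewrite /aff ofVK addr0 quadZ sqr_sqrtr// ltW.
have Q q : (s * q <= s) = (q <= 1) by rewrite -{2}[s]mulr1 ler_pM2l.
by split => y; rewrite /ellipsoid /= E Q.
Qed.

Lemma vol_ellipsoid_lt0 m (G : 'M[R]_m) s : posdef G -> s < 0 -> ellipsoid G s = set0.
Proof.
move=> pG s0; apply/seteqP; split => // y; rewrite /ellipsoid /= leNgt => /negP; apply.
exact: lt_le_trans s0 (quad_ge0 _ pG).
Qed.

(** Vanishing is only known for negative [s]; the point 0 is a null set, so the open half-line of
    the Gamma integral can be used. *)
Lemma integral_half_line (h : R -> \bar R) : measurable_fun setT h ->
  (forall s, s < 0 -> h s = 0%E) ->
  (\int[leb]_s h s = \int[leb]_(s in `]0%R, +oo[) h s)%E.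
Proof.
move=> mh h0; rewrite integral_itv_obnd_cbnd; last exact: measurable_funTS.
rewrite [RHS]integral_mkcond; apply: eq_integral => s _.
rewrite patchE; case: ifPn => //; rewrite notin_setE /= in_itv /= andbT => /negP.
by rewrite -ltNge => /h0.
Qed.

(* The integrand is the indicator of s >= q times exp(- s). *)
Lemma expR_layer (q : R) :
  ((expR (- q))%:E = \int[leb]_s (expR (- q) * exponential_pdf 1 (s - q))%:E)%E.
Proof.
pose g (x : R) := (exponential_pdf 1 x)%:E.
have mg : measurable_fun setT g by apply/measurable_EFinP; exact: measurable_exponential_pdf.
have g0 x : (0 <= g x)%E by rewrite lee_fin exponential_pdf_ge0.
rewrite (_ : (fun s => _) = (fun s => (expR (- q))%:E * g (1 * s + (- q))%R)%E); last first.
  by apply/funext => s; rewrite mul1r EFinM.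
rewrite ge0_integralZl ?lee_fin ?expR_ge0//; last first.
  by apply: (measurableT_comp mg); exact: measurable_aff1.
have := integral_aff1 (- q) ltr01 mg g0; rewrite mul1e => <-.
by rewrite integral_exponential_pdf// mule1.
Qed.

(** Expand the integrand by [expR_layer] and exchange the integrals. At height [s] the inner
    integral is [expR (- s)] times the volume of the ellipsoid of squared radius [s], which scaling
    reduces to squared radius 1. *)
Lemma integral_layer m (G : 'M[R]_m) : posdef G ->
  (\int[vol m]_y (expR (- quad G (toV y)))%:E =
   vol m (ellipsoid G 1) * \int[leb]_(t in `]0%R, +oo[) (t `^ (m%:R / 2) * expR (- t))%:E)%E.
Proof.
move=> pG.
pose f (z : euclid m * R) : R :=
  expR (- quad G (toV z.1)) * exponential_pdf 1 (z.2 - quad G (toV z.1)).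
have f0 z : 0 <= f z by rewrite mulr_ge0 ?expR_ge0 ?exponential_pdf_ge0.
have fE y s : f (y, s) = expR (- s) * \1_(ellipsoid G s) y.
  rewrite /f /= indicE; case: (boolP (y \in _)); rewrite ?inE ?notin_setE /ellipsoid /=.
    move=> qs; rewrite exponential_pdfE ?subr_ge0// mul1r -expRD mulr1.
    by congr expR; ring.
  by move=> /negP; rewrite -ltNge => qs; rewrite lt0_exponential_pdf ?subr_lt0// !mulr0.
have mq : measurable_fun setT (fun z : euclid m * R => quad G (toV z.1)).
  by apply: (measurableT_comp (measurable_quad G)).
have mf : measurable_fun setT (EFin \o f).
  apply/measurable_EFinP; apply: measurable_funM.
    by apply: measurableT_comp => //; apply: measurableT_comp.
  apply: (measurableT_comp (measurable_exponential_pdf 1)).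
  exact: measurable_funB.
transitivity (\int[vol m]_y \int[leb]_s (EFin \o f) (y, s))%E.
  by apply: eq_integral => y _; rewrite expR_layer.
rewrite (fubini_tonelli (m1 := vol m) (m2 := leb) (EFin \o f))//.
pose h s := ((expR (- s))%:E * vol m (ellipsoid G s))%E.
have hE s : (\int[vol m]_y (EFin \o f) (y, s) = h s)%E.
  rewrite (_ : (fun y => _) = (fun y => (expR (- s))%:E * (\1_(ellipsoid G s) y)%:E)%E); last first.
    by apply/funext => y; rewrite /= fE EFinM.
  rewrite ge0_integralZl ?lee_fin ?expR_ge0//; last first.
    by apply/measurable_EFinP; apply: measurable_indic; exact: measurable_ellipsoid.
  by rewrite integral_indic ?setIT//; exact: measurable_ellipsoid.
have mh : measurable_fun setT h.
  have := measurable_fun_fubini_tonelli_G (m1 := vol m) (EFin \o f) mf (fun z => f0 z).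
  by congr measurable_fun; apply/funext => s; rewrite /fubini_G hE.
under eq_integral do rewrite hE.
rewrite integral_half_line//; last first.
  by move=> s s0; rewrite /h vol_ellipsoid_lt0// measure0 mule0.
rewrite -ge0_integralZl//; last 2 first.
- by apply/measurable_EFinP; apply: measurable_funM => //; [exact: measurable_funTS|
    apply: measurableT_comp => //; exact: measurable_funTS].
- by move=> s _; rewrite lee_fin mulr_ge0 ?powR_ge0 ?expR_ge0.
apply: eq_integral => s; rewrite inE /= in_itv /= andbT => s0.
by rewrite /h vol_ellipsoid_scale// EFinM muleA muleC; congr (_ * _)%E; rewrite muleC.
Qed.

(** As 0 times infinity is 0, a positive finite product forces both factors to be positive and
    finite. This yields finiteness of the ellipsoid volume and of the Gamma integral at once. *)
Lemma mule_pos_fin (x y : \bar R) (c : R) : (0 <= x)%E -> (0 <= y)%E -> 0 < c ->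
  (c%:E = x * y)%E -> exists a b : R, [/\ x = a%:E, y = b%:E, 0 < a & 0 < b].
Proof.
case: x y => [a| |] [b| |] //; rewrite ?lee_fin => a0 b0 c0.
- rewrite -EFinM => -[cE]; exists a, b; split=> //; rewrite lt_neqAle ?a0 ?b0 andbT eq_sym;
  by apply: contraTneq c0 => e; rewrite cE e ?mulr0 ?mul0r ltxx.
- have [->|an] := eqVneq a 0; first by rewrite mul0e => -[cE]; rewrite cE ltxx in c0.
  by rewrite gt0_muley// lte_fin lt_neqAle eq_sym an.
- have [->|bn] := eqVneq b 0; first by rewrite mule0 => -[cE]; rewrite cE ltxx in c0.
  by rewrite gt0_mulye// lte_fin lt_neqAle eq_sym bn.
Qed.

(** The two evaluations of the Gaussian integral, by squares and by layers, give an equation that is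
    solved for the volume. *)
Lemma vol_ellipsoid1 m (G : 'M[R]_m) : posdef G ->
  0 < real_fact (m%:R / 2 : R) /\
  vol m (ellipsoid G 1) = (ball_vol R m / Num.sqrt (\det G))%:E.
Proof.
move=> pG; have [dG IG] := integral_gauss pG.
have c0 : 0 < Num.sqrt pi ^+ m / Num.sqrt (\det G) :> R.
  by rewrite divr_gt0 ?exprn_gt0 ?sqrtr_gt0// pi_gt0.
have := integral_layer pG; rewrite IG => E.
have I0 : (0 <= \int[leb]_(t in `]0%R, +oo[) (t `^ (m%:R / 2) * expR (- t))%:E)%E.
  by apply: integral_ge0 => s _; rewrite lee_fin mulr_ge0 ?powR_ge0 ?expR_ge0.
have [a [b [aE bE a0 b0]]] := mule_pos_fin (measure_ge0 _ _) I0 c0 E.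
have rE : real_fact (m%:R / 2) = b.
  by rewrite /real_fact /gamma_fun addrK /Rintegral bE.
rewrite rE; split=> //; rewrite aE; congr EFin.
move: E; rewrite aE bE -EFinM => -[] E.
rewrite /ball_vol rE powR_half ?pi_ge0// mulrAC E mulfK// gt_eqF//.
Qed.

Lemma posdef1 m : posdef (1%:M : 'M[R]_m).
Proof.
split; first by rewrite trmx1.
move=> v v0; rewrite /quad mulmx1 mxE.
rewrite lt_neqAle eq_sym psumr_neq0; last by move=> i _; rewrite mxE -expr2 sqr_ge0.
rewrite sumr_ge0 ?andbT; last by move=> i _; rewrite mxE -expr2 sqr_ge0.
have /rV0Pn[i vi] := v0; apply/hasP; exists i; first by rewrite mem_index_enum.
by rewrite mxE -expr2 exprn_even_gt0.
Qed.

Lemma ball_vol_gt0 m : 0 < ball_vol R m.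
Proof.
have [f0 _] := vol_ellipsoid1 (posdef1 m).
by rewrite /ball_vol divr_gt0// powR_gt0// pi_gt0.
Qed.

Lemma vol_ellipsoid m (G : 'M[R]_m) s : posdef G -> 0 < s ->
  vol m (ellipsoid G s) = (ball_vol R m * s `^ (m%:R / 2) / Num.sqrt (\det G))%:E.
Proof.
move=> pG s0; rewrite vol_ellipsoid_scale//; have [_ ->] := vol_ellipsoid1 pG.
by rewrite -EFinM; congr EFin; ring.
Qed.

End ellipsoid_volume.

(** * Unfolding over the integer lattice *)

Lemma pickle_inv_some (T : countType) i (x : T) : pickle_inv i = Some x -> i = pickle x.
Proof. by move=> E; have := @pickle_invK T i; rewrite E. Qed.

Section unfolding.
Context {R : realType} (m : nat).
Implicit Types (F : set (@euclid R m)) (z : 'rV[int]_m).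

Definition intv n (z : 'rV[int]_n) : 'rV[R]_n := map_mx intr z.

(** Half-open, so that it is an exact fundamental domain of the integer lattice. *)
Definition cube n : set (@euclid R n) := [set y | forall i, 0 <= toV y 0 i < 1].
Arguments cube : clear implicits.

Lemma toV_head n (y : @euclid R n.+1) : toV y 0 0 = y.1.
Proof. by rewrite /= mxE split1 unlift_none /= mxE. Qed.

Lemma toV_tail n (y : @euclid R n.+1) i : toV y 0 (lift ord0 i) = toV y.2 0 i.
Proof. by rewrite /= mxE split1 liftK. Qed.

Lemma cubeS n : cube n.+1 = `[0, 1[%classic `*` cube n.
Proof.
apply/seteqP; split => [y h|y [/=]].
  split => [|i] /=; first by have := h 0; rewrite toV_head in_itv.
  by have := h (lift ord0 i); rewrite toV_tail.
rewrite in_itv => /= hx hy i.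
have [j ->|->] := unliftP ord0 i; first by rewrite toV_tail; exact: hy.
by rewrite toV_head.
Qed.

Lemma cube_spec n : measurable (cube n) /\ vol n (cube n) = 1%E.
Proof.
elim: n => [|n [mC vC]].
  have -> : cube 0 = setT by apply/seteqP; split => // y _ -[].
  by split => //; rewrite /vol /= diracT.
rewrite cubeS; split; first exact: measurableX.
have l1 : (@lebesgue_measure R `[0%R, 1%R[%classic = 1)%E.
  by rewrite lebesgue_measure_itv /= lte_fin ltr01 oppr0 adde0.
rewrite /vol /= /line_prod product_measure1E// -[RHS]mule1; congr (_ * _)%E.
  exact: l1.
exact: vC.
Qed.

(** The part of [F] in the unit cube with corner [z], moved back to the cube at the origin. *)
Definition shift_cell F z : set (euclid m) := cube m `&` aff 1 (intv z) @^-1` F.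

Lemma measurable_aff_preimage c v F : measurable F -> measurable (aff c v @^-1` F).
Proof. by move=> mF; rewrite -[_ @^-1` _]setTI; exact: measurable_aff. Qed.

Lemma measurable_shift_cell F z : measurable F -> measurable (shift_cell F z).
Proof.
move=> mF; apply: measurableI; [exact: (cube_spec m).1|exact: measurable_aff_preimage].
Qed.

Lemma affK c (v w : 'rV[R]_m) d y : aff c v (aff d w y) = aff (c * d) (c *: w + v) y.
Proof. by rewrite /aff ofVK scalerDr scalerA addrA. Qed.

Lemma aff1_0 y : aff 1 (0 : 'rV[R]_m) y = y.
Proof. by rewrite /aff scale1r addr0 toVK. Qed.

(* [pickle_inv] enumerates [Z^m]; indices that encode no vector contribute nothing. *)
Definition cell F (i : nat) : set (euclid m) :=
  if pickle_inv i is Some z then shift_cell F z else set0.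

Lemma measurable_cell F i : measurable F -> measurable (cell F i).
Proof. by move=> mF; rewrite /cell; case: pickle_inv => // z; exact: measurable_shift_cell. Qed.

Definition intpart (y : @euclid R m) : 'rV[int]_m := \row_i Num.floor (toV y 0 i).

Lemma intpartE (y : euclid m) z : cube m (aff 1 (- intv z) y) <-> z = intpart y.
Proof.
split=> [h|-> i].
  apply/rowP => i; rewrite mxE; apply/esym/floor_def.
  have := h i; rewrite /aff ofVK scale1r !mxE.
  by rewrite subr_ge0 ltrBlDr intrD addrC => /andP[-> ->].
rewrite /aff ofVK scale1r !mxE subr_ge0 ltrBlDr.
by rewrite floor_le_tmp /= addrC -intrD1 floorD1_gt.
Qed.

(** Sort the points of [F] by their integer parts; translation to the base cube preserves volume. *)
Lemma vol_unfold F : measurable F -> (vol m F = \sum_(i <oo) vol m (cell F i))%E.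
Proof.
move=> mF.
pose D i : set (euclid m) := if pickle_inv i is Some z then F `&` [set y | intpart y = z] else set0.
have DE z : F `&` [set y | intpart y = z] = aff 1 (- intv z) @^-1` shift_cell F z.
  apply/seteqP; split => y /=; rewrite /shift_cell /= affK mulr1 scale1r addNr aff1_0.
    by move=> [Fy yz]; split => //; apply/intpartE.
  by move=> [/intpartE <-].
have mD i : measurable (D i).
  rewrite /D; case: pickle_inv => // z; rewrite DE.
  by apply: measurable_aff_preimage; exact: measurable_shift_cell.
have FE : F = \bigcup_i D i.
  apply/seteqP; split => [y Fy|y [i _]].
    by exists (pickle (intpart y)) => //; rewrite /D pickleK_inv.
  by rewrite /D; case: pickle_inv => // z [].
rewrite [in LHS]FE measure_semi_bigcup//; last 2 first.
- apply/trivIsetP => i j _ _ ij; apply/seteqP; split => // y [].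
  rewrite /D; case Ei: (pickle_inv i) => [z|//] [_ yz].
  case Ej: (pickle_inv j) => [z'|//] [_ yz'].
  move: ij; rewrite (pickle_inv_some Ei) (pickle_inv_some Ej).
  by move: yz yz' => /= -> ->; rewrite eqxx.
- exact: bigcupT_measurable.
apply: eq_eseriesr => i _; rewrite /D /cell; case: pickle_inv => // z; rewrite DE.
rewrite [RHS](vol_aff (- intv z) ltr01); last exact: measurable_shift_cell.
by rewrite expr1n mul1e.
Qed.

(** The image of [F] in the torus, represented inside the fundamental cube. *)
Definition fold_torus F := \bigcup_i cell F i.

Lemma fold_torusP F y : cube m y -> (exists z, F (aff 1 (intv z) y)) -> fold_torus F y.
Proof.
by move=> cy [z Fz]; exists (pickle z) => //; rewrite /cell pickleK_inv.
Qed.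

Lemma measurable_fold_torus F : measurable F -> measurable (fold_torus F).
Proof. by move=> mF; apply: bigcupT_measurable => i; exact: measurable_cell. Qed.

(** Only an inequality: cells overlap where points of [F] differ by an integer vector. *)
Lemma vol_fold_torus F : measurable F -> (vol m (fold_torus F) <= vol m F)%E.
Proof.
move=> mF; rewrite (vol_unfold mF); apply: measure_sigma_subadditive => //.
  by move=> i; exact: measurable_cell.
exact: measurable_fold_torus.
Qed.

(** The hypothesis says that [F] embeds into the torus, so its cells are disjoint subsets of a cube
    of volume 1. *)
Lemma vol_packing F : measurable F ->
  (forall y z z', F (aff 1 (intv z) y) -> F (aff 1 (intv z') y) -> z = z') ->
  (vol m F <= 1)%E.
Proof.
move=> mF inj; have [mC <-] := cube_spec m; rewrite (vol_unfold mF) -measure_semi_bigcup.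
- apply: le_measure; rewrite ?inE//; first exact: measurable_fold_torus.
  by move=> y [i _]; rewrite /cell; case: pickle_inv => // z [].
- by move=> i; exact: measurable_cell.
- apply/trivIsetP => i j _ _ ij; apply/seteqP; split => // y [].
  rewrite /cell; case Ei: (pickle_inv i) => [z|//] [_ yz].
  case Ej: (pickle_inv j) => [z'|//] [_ yz'].
  by move: ij; rewrite (pickle_inv_some Ei) (pickle_inv_some Ej) (inj _ _ _ yz yz') eqxx.
- exact: measurable_fold_torus.
Qed.

Lemma vol_covering (I : choiceType) (s : seq I) (A : I -> set (euclid m)) :
  (forall i, measurable (A i)) ->
  (forall y, cube m y -> exists2 i, i \in s & exists z, A i (aff 1 (intv z) y)) ->
  (1 <= \sum_(i <- s) vol m (A i))%E.
Proof.
move=> mA cov; have [mC <-] := cube_spec m.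
pose U := \big[setU/set0]_(i <- s) fold_torus (A i).
have mU : measurable U by apply: bigsetU_measurable => i _; exact: measurable_fold_torus.
apply: (@le_trans _ _ (vol m U)).
  apply: le_measure; rewrite ?inE// => y cy; have [i is_ h] := cov _ cy.
  rewrite /U -bigcup_seq; exists i => //; exact: fold_torusP.
rewrite {mU}/U; elim: s {cov} => [|i s IH]; first by rewrite !big_nil measure0.
rewrite !big_cons; apply: le_trans (measureU2 _ _ _) _.
- exact: measurable_fold_torus.
- by apply: bigsetU_measurable => j _; exact: measurable_fold_torus.
- by apply: leeD => //; exact: vol_fold_torus.
Qed.

End unfolding.

(** * Counting primitive residues *)

Section mobius.
Implicit Types (p l g k : nat).

Lemma mobius_sqr p l : (0 < l)%N -> prime p -> (p ^ 2 %| l)%N -> mobius l = 0.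
Proof.
move=> l0 pp pl; rewrite /mobius ifT//; apply/hasP; exists p => //.
by rewrite mem_primes pp l0 (dvdn_trans _ pl)// expnS dvdn_mulr.
Qed.

Lemma mobius_mul_prime p l : (0 < l)%N -> prime p -> ~~ (p %| l)%N ->
  mobius (p * l) = - mobius l.
Proof.
move=> l0 pp npl; have p0 := prime_gt0 pp.
have P : perm_eq (primes (p * l)) (p :: primes l).
  apply: uniq_perm; rewrite /= ?primes_uniq ?andbT//.
    by rewrite mem_primes pp l0.
  by move=> q; rewrite primesM// primes_prime// !inE.
rewrite /mobius (perm_has _ P) (perm_size P) /= exprS mulN1r.
have -> : (p ^ 2 %| p * l)%N = false by rewrite expnS expn1 dvdn_pmul2l// (negbTE npl).
have -> : has (fun q => (q ^ 2 %| p * l)%N) (primes l) = has (fun q => (q ^ 2 %| l)%N) (primes l).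
  apply: eq_in_has => q; rewrite mem_primes => /and3P[qp _ ql].
  rewrite Gauss_dvdr// coprime_pexpl// prime_coprime// dvdn_prime2//.
  by apply: contraNneq npl => <-.
by rewrite orFb; case: has; rewrite ?oppr0.
Qed.

(** For a prime [p] dividing [g], the divisors split into those prime to [p], those divisible by [p]
    once, and multiples of [p ^ 2]. The last contribute 0, and multiplication by [p] matches the
    first two classes with opposite signs. *)
Lemma sum_mobius_divisors g : (0 < g)%N -> \sum_(l <- divisors g) mobius l = (g == 1)%:R.
Proof.
move=> g0; have [->|g1] := eqVneq g 1%N; first by rewrite big_seq1.
have [p pp pg] : exists2 p, prime p & (p %| g)%N.
  by exists (pdiv g); [apply: pdiv_prime; case: g g0 g1 => [|[]]|exact: pdiv_dvd].
have p0 := prime_gt0 pp.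
have dvd0 l : (l %| g)%N -> (0 < l)%N by exact: dvdn_gt0.
pose A := [seq l <- divisors g | ~~ (p %| l)%N].
pose B := [seq l <- divisors g | (p %| l)%N && ~~ (p ^ 2 %| l)%N].
have PB : perm_eq B (map (muln p) A).
  apply: uniq_perm.
  - by rewrite filter_uniq// divisors_uniq.
  - by rewrite map_inj_uniq ?filter_uniq ?divisors_uniq// => x y /eqP; rewrite eqn_pmul2l// => /eqP.
  move=> l; rewrite mem_filter -dvdn_divisors//; apply/idP/mapP.
    move=> /andP[/andP[/dvdnP[l' ->]] + lg]; rewrite mulnC expnS expn1 dvdn_pmul2l// => npl.
    exists l' => //; rewrite mem_filter npl -dvdn_divisors//.
    by rewrite (dvdn_trans _ lg)// dvdn_mulr.
  move=> [l']; rewrite mem_filter -dvdn_divisors// => /andP[npl l'g] ->.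
  rewrite dvdn_mulr// expnS expn1 dvdn_pmul2l// npl /=.
  by rewrite Gauss_dvd ?pg ?l'g// prime_coprime.
rewrite (bigID (fun l => p %| l)%N) /= addrC -big_filter -/A.
have -> : \sum_(l <- divisors g | (p %| l)%N) mobius l = \sum_(l <- B) mobius l.
  rewrite big_filter (bigID (fun l => p ^ 2 %| l)%N) /= big_seq_cond big1 ?add0r//.
  move=> l /and3P[]; rewrite -dvdn_divisors// => lg _ p2l.
  exact: mobius_sqr (dvd0 _ lg) pp p2l.
rewrite (perm_big _ PB) big_map /=.
have -> : \sum_(l <- A) mobius (p * l) = - \sum_(l <- A) mobius l.
  rewrite -sumrN; apply: eq_big_seq => l.
  rewrite mem_filter -dvdn_divisors// => /andP[npl lg].
  exact: mobius_mul_prime (dvd0 _ lg) pp npl.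
exact: subrr.
Qed.

(** The gcd of [k] and all coordinates is 1, tested on primes; for [k = 1] every vector
    qualifies. *)
Definition primitive_mod m k (z : {ffun 'I_m -> 'I_k}) : bool :=
  ~~ has (fun p => [forall i, (p %| z i)%N]) (primes k).

Lemma card_dvd_ord k l : (0 < k)%N -> (l %| k)%N -> #|[pred j : 'I_k | (l %| j)%N]| = (k %/ l)%N.
Proof.
move=> k0 lk; rewrite divn_count_dvd -sum1_card.
rewrite (eq_bigl (fun j : 'I_k => (l %| j)%N))//.
rewrite -(big_mkord (fun j => (l %| j)%N) (fun=> 1%N)) big_mkcond /=.
(* One side counts over 0, ..., k - 1, the other over 1, ..., k; the index 0 is traded for [k], both
   being multiples of [l]. *)
rewrite -(prednK k0) big_nat_recl// dvdn0 big_nat_recr//= prednK// lk addnC.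
congr (_ + _)%N; rewrite [RHS]big_add1 /=.
by apply: eq_bigr => i _; case: (l %| _)%N.
Qed.

Lemma card_dvd_ffun m k l : (0 < k)%N -> (l %| k)%N ->
  #|[pred z : {ffun 'I_m -> 'I_k} | [forall i, (l %| z i)%N]]| = ((k %/ l) ^ m)%N.
Proof.
move=> k0 lk; rewrite -(card_dvd_ord k0 lk) -[X in (_ ^ X)%N]card_ord -card_ffun_on.
apply: eq_card => z; rewrite [LHS]inE.
by apply/forallP/ffun_onP => h i; have := h i; rewrite !inE.
Qed.

(** The divisors of the gcd [g] of [k] and the coordinates are exactly the indices of the sum, which
    is therefore the indicator of [g = 1]. *)
Lemma primitive_modE m k (z : {ffun 'I_m -> 'I_k}) : (0 < k)%N ->
  (primitive_mod z)%:R = \sum_(l <- divisors k | [forall i, (l %| z i)%N]) mobius l.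
Proof.
move=> k0; pose g := \big[gcdn/k]_i (z i : nat).
have gk : (g %| k)%N.
  by rewrite /g; elim/big_rec: _ => // i x _ h; rewrite (dvdn_trans _ h)// dvdn_gcdr.
have gz i : (g %| z i)%N by rewrite /g (bigD1 i)//= dvdn_gcdl.
have dvdg l : (l %| g)%N = (l %| k)%N && [forall i, (l %| z i)%N].
  apply/idP/andP => [lg|[lk /forallP lz]].
    by split; [exact: dvdn_trans gk|apply/forallP => i; exact: dvdn_trans (gz i)].
  by rewrite /g; elim/big_rec: _ => // i x _ h; rewrite dvdn_gcd lz.
have g0 : (0 < g)%N by exact: dvdn_gt0 gk.
transitivity (\sum_(l <- divisors g) mobius l).
  rewrite sum_mobius_divisors//; congr (_%:R); congr nat_of_bool.
  apply/idP/eqP => [|g1].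
    move=> /hasPn h; apply/eqP; apply: contraT => g1.
    have pp : prime (pdiv g) by apply: pdiv_prime; case: (g) g0 g1 => [|[]].
    have := pdiv_dvd g; rewrite dvdg => /andP[pk pz].
    by have := h (pdiv g); rewrite mem_primes pp k0 pk pz => /(_ isT).
  apply/hasPn => p; rewrite mem_primes => /and3P[pp _ pk]; apply/negP => pz.
  have : (p %| g)%N by rewrite dvdg pk.
  by rewrite g1 dvdn1 => /eqP p1; rewrite p1 in pp.
rewrite -[RHS]big_filter; apply: perm_big; apply: uniq_perm.
- exact: divisors_uniq.
- by rewrite filter_uniq// divisors_uniq.
by move=> l; rewrite mem_filter -!dvdn_divisors// dvdg andbC.
Qed.

(** Summing the indicator over all residue vectors, each [l] counts the [(k / l) ^ m] vectors with
    all coordinates divisible by [l]. *)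
Lemma card_primitive_mod (R : numFieldType) m k : (0 < k)%N ->
  #|[pred z : {ffun 'I_m -> 'I_k} | primitive_mod z]|%:R / k%:R ^+ m =
  \sum_(l <- divisors k) (mobius l)%:~R / l%:R ^+ m :> R.
Proof.
move=> k0; have kn0 : k%:R != 0 :> R by rewrite pnatr_eq0 -lt0n.
have -> : #|[pred z : {ffun 'I_m -> 'I_k} | primitive_mod z]|%:R =
   (\sum_(z : {ffun 'I_m -> 'I_k}) (primitive_mod z)%:R : int)%:~R :> R.
  rewrite -sum1_card (eq_bigl (@primitive_mod m k))// natr_sum big_mkcond /= [RHS]rmorph_sum /=.
  by apply: eq_bigr => z _; case: primitive_mod.
under eq_bigr do rewrite primitive_modE// big_mkcond /=.
rewrite exchange_big /= rmorph_sum /= mulr_suml big_seq [RHS]big_seq.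
apply: eq_bigr => l; rewrite -dvdn_divisors// => lk.
have l0 : l%:R != 0 :> R by rewrite pnatr_eq0 -lt0n (dvdn_gt0 k0 lk).
rewrite -big_mkcond /= sumr_const card_dvd_ffun// rmorphMn /= -mulr_natr -mulrA; congr (_ * _).
rewrite natrX -expr_div_n -exprVn; congr (_ ^+ m).
have kl0 : (0 < k %/ l)%N by rewrite divn_gt0 ?(dvdn_gt0 k0 lk)// dvdn_leq.
by rewrite -{2}(divnK lk) natrM invfM mulrA mulfV ?mul1r// pnatr_eq0 -lt0n.
Qed.

End mobius.

(** * Lattices with a basis *)

Section lattices.
Context {R : realType}.

Lemma continuous_sum (T : topologicalType) (I : Type) (s : seq I) (f : I -> T -> R) :
  (forall i, continuous (f i)) -> continuous (fun x => \sum_(i <- s) f i x).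
Proof.
move=> cf; elim: s => [|i s IH].
  rewrite (_ : (fun x => _) = fun=> 0); first exact: cst_continuous.
  by apply/funext => x; rewrite big_nil.
rewrite (_ : (fun x => _) = fun x => f i x + \sum_(j <- s) f j x).
  by move=> x; apply: cvgD; [exact: cf|exact: IH].
by apply/funext => x; rewrite big_cons.
Qed.

Lemma continuous_mulmx_coord m n (B : 'M[R]_(m, n)) i :
  continuous (fun v : 'rV[R]_m => (v *m B) 0 i).
Proof.
rewrite (_ : (fun _ => _) = (fun v : 'rV[R]_m => \sum_j v 0 j * B j i)); last first.
  by apply/funext => v; rewrite mxE.
apply: continuous_sum => j v; apply: continuousM; last exact: cst_continuous.
exact: coord_continuous.
Qed.

Lemma continuous_mulmxr m n (B : 'M[R]_(m, n)) : continuous (fun v : 'rV[R]_m => v *m B).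
Proof.
move=> v A /= [P vP PA].
have : \forall w \near v, forall i, P 0 i ((w *m B) 0 i).
  apply: (@filter_forall _ _ (fun i (w : 'rV[R]_m) => P 0 i ((w *m B) 0 i)) (nbhs v)) => i.
  exact: (continuous_mulmx_coord (vP 0 i)).
by apply: filterS => w h; apply: PA => i j; rewrite (ord1 i); exact: h.
Qed.

Definition lat m (B : 'M[R]_m) : set 'rV[R]_m := [set intv z *m B | z in [set: 'rV[int]_m]].

Lemma lat_is_lattice m (B : 'M[R]_m) : row_free B -> is_lattice (lat B).
Proof.
rewrite row_free_unit => uB; split.
- by exists 0 => //; rewrite /intv raddf0 mul0mx.
- by move=> _ _ [z _ <-] [w _ <-]; exists (z - w) => //; rewrite /intv raddfB mulmxBl.
- move=> _ [z _ <-]; split; first by rewrite inE; exists z.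
  (* In this neighbourhood the coordinates with respect to [B] differ from those of [z] by less than
     1, which leaves [z] as the only integer vector. *)
  exists [set w | forall i, `|(w *m invmx B) 0 i - (z 0 i)%:~R| < 1].
    apply: (@filter_forall _ _
      (fun i (w : 'rV[R]_m) => `|(w *m invmx B) 0 i - (z 0 i)%:~R| < 1)
      (nbhs (intv z *m B))) => i.
    have /cvgr_dist_lt/(_ _ ltr01) H := @continuous_mulmx_coord _ _ (invmx B) i (intv z *m B).
    apply: filterS H => w; rewrite /= (mulmxK uB) distrC.
    by rewrite [intv z 0 i]mxE.
  apply/seteqP; split => [x [/= h [w _ E]]|x ->]; last first.
    by split => [i|]; [rewrite mulmxK// mxE subrr normr0|exists z].
  rewrite -E in h *; congr (intv _ *m B); apply/rowP => i; have := h i.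
  rewrite mulmxK// mxE -intrB -intr_norm -[1]/(1%:~R) ltr_int.
  by rewrite -(add0r (1 : int)) ltzD1 normr_le0 subr_eq0 => /eqP.
(* The closed fundamental parallelepiped is compact; subtracting the integer parts of the
   coordinates leads into it. *)
- exists [set v *m B | v in [set v : 'rV[R]_m | forall i, `[0, 1]%classic (v 0 i)]].
    apply: continuous_compact; first exact/continuous_subspaceT/continuous_mulmxr.
    exact: (@rV_compact R m (fun=> `[0, 1]%classic) (fun i => @segment_compact _ 0 1)).
  move=> x; pose z := \row_i Num.floor ((x *m invmx B) 0 i).
  exists (intv z *m B); first by exists z.
  exists (x *m invmx B - intv z); last by rewrite mulmxBl mulmxKV.
  move=> i; rewrite /= in_itv /= !mxE subr_ge0 lerBlDr.
  by rewrite floor_le_tmp /= addrC -intrD1 ltW// floorD1_gt.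
Qed.

Lemma det_gram m (B : 'M[R]_m) : \det (gram B) = \det B ^+ 2.
Proof.
rewrite expr2 -[X in _ = _ * X]det_tr -det_mulmx; congr (\det _); apply/matrixP => i j.
by rewrite !mxE /dotv; apply: eq_bigr => k _; rewrite !mxE.
Qed.

Lemma lat_sub_mx m (B C : 'M[R]_m) : lat B `<=` lat C ->
  exists U : 'M[int]_m, B = map_mx intr U *m C.
Proof.
move=> BC.
have H i : exists z : 'rV[int]_m, intv z *m C = row i B.
  have [|z _ <-] := BC (row i B); last by exists z.
  exists (delta_mx 0 i) => //; rewrite rowE; congr (_ *m B).
  by apply/matrixP => a b; rewrite !mxE; case: (_ && _).
have [f fE] := choice H.
exists (\matrix_i f i); apply/row_matrixP => i; rewrite row_mul -fE; congr (_ *m C).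
by apply/rowP => j; rewrite !mxE.
Qed.

(** Two bases of one lattice differ by integer matrices whose determinants multiply to 1, hence are
    1 or -1. So the basis picked by [xget] does not matter. *)
Lemma lattice_det_lat m (B : 'M[R]_m) : row_free B -> lattice_det (lat B) = \det B ^+ 2.
Proof.
move=> fB; rewrite /lattice_det.
have : [set \det (gram B) | B in lattice_basis (lat B)] !=set0.
  by exists (\det (gram B)); exists B.
move=> /(@xgetPex _ 0) [C [fC BC] <-]; rewrite det_gram.
have BC' : lat B = lat C by rewrite BC.
have [U BU] : exists U : 'M[int]_m, B = map_mx intr U *m C by apply: lat_sub_mx; rewrite BC'.
have [W CW] : exists U : 'M[int]_m, C = map_mx intr U *m B by apply: lat_sub_mx; rewrite BC'.
have dB : \det B = (\det U)%:~R * \det C by rewrite {1}BU det_mulmx det_map_mx.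
have dC : \det C = (\det W)%:~R * \det B by rewrite {1}CW det_mulmx det_map_mx.
have d0 : \det C != 0 by rewrite -unitfE -unitmxE -row_free_unit.
have /eqP : \det W * \det U = 1.
  apply/eqP; rewrite -(eqr_int R) intrM; apply/eqP/(mulIf d0).
  by rewrite -mulrA -dB -dC mul1r.
move=> /eqP /(intUnitRing.unitzPl) /= /orP[] /eqP uU;
  by rewrite dB uU ?mulrN1z exprMn ?sqrrN expr1n mul1r.
Qed.

End lattices.

(** * Bounds on the density *)

Section density.
Context {R : realType}.

Lemma dotv_ge0 m (v : 'rV[R]_m) : 0 <= dotv v v.
Proof. by apply: sumr_ge0 => i _; rewrite -expr2 sqr_ge0. Qed.

Lemma dotv_gt0 m (v : 'rV[R]_m) : v != 0 -> 0 < dotv v v.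
Proof.
move=> v0; have [_ /(_ v v0)] := @posdef1 R m.
by rewrite /quad mulmx1 mxE /dotv; under eq_bigr do rewrite mxE.
Qed.

Lemma dotvZ m c (v : 'rV[R]_m) : dotv (c *: v) (c *: v) = c ^+ 2 * dotv v v.
Proof. by rewrite /dotv mulr_sumr; apply: eq_bigr => i _; rewrite !mxE; ring. Qed.

Lemma dotvB_le m (u v : 'rV[R]_m) :
  dotv (u - v) (u - v) <= 2 * dotv u u + 2 * dotv v v.
Proof.
rewrite /dotv !mulr_sumr -big_split /=; apply: ler_sum => i _; rewrite !mxE.
by have := sqr_ge0 (u 0 i + v 0 i); nra.
Qed.

Lemma quad_gram m (B : 'M[R]_m) v : quad (B *m B^T) v = dotv (v *m B) (v *m B).
Proof.
rewrite /quad mulmxA -mulmxA -trmx_mul mxE /dotv.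
by apply: eq_bigr => i _; rewrite [in X in _ * X]mxE.
Qed.

Lemma posdef_gram m (B : 'M[R]_m) : row_free B -> posdef (B *m B^T).
Proof.
move=> fB; split; first by rewrite trmx_mul trmxK.
move=> v v0; rewrite quad_gram; apply: dotv_gt0.
by rewrite mulmx_free_eq0.
Qed.

Lemma sqrt_det_gram m (B : 'M[R]_m) : Num.sqrt (\det (B *m B^T)) = `|\det B|.
Proof. by rewrite det_mulmx det_tr -expr2 sqrtr_sqr. Qed.

Lemma det_row_free m (B : 'M[R]_m) : row_free B -> 0 < `|\det B|.
Proof. by rewrite row_free_unit unitmxE unitfE normr_gt0. Qed.

Lemma lattice_min_ge0 m (L : set 'rV[R]_m) : 0 <= lattice_min L.
Proof.
rewrite /lattice_min; set S := [set _ | _ in _].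
have [->|S0] := eqVneq S set0; first by rewrite inf0.
apply: lb_le_inf; first exact/set0P.
by move=> _ [v _ <-]; exact: dotv_ge0.
Qed.

Lemma lattice_min_le m (L : set 'rV[R]_m) v : L v -> v != 0 -> lattice_min L <= dotv v v.
Proof.
move=> Lv v0; apply: ge_inf; last by exists v => //; split => //; exact/eqP.
by exists 0 => _ [w _ <-]; exact: dotv_ge0.
Qed.

Lemma intv_eq0 m (z : 'rV[int]_m) : (intv z == 0 :> 'rV[R]_m) = (z == 0).
Proof.
apply/eqP/eqP => [|->]; last by rewrite /intv raddf0.
move/rowP => h; apply/rowP => i; have := h i; rewrite !mxE => /eqP.
by rewrite intr_eq0 => /eqP.
Qed.

Lemma lattice_min_lat_le m (B : 'M[R]_m) z : row_free B -> z != 0 ->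
  lattice_min (lat B) <= dotv (intv z *m B) (intv z *m B).
Proof.
move=> fB z0; apply: lattice_min_le; first by exists z.
by rewrite mulmx_free_eq0// intv_eq0.
Qed.

(** Positive dimension provides a nonzero lattice vector; [inf] of the empty set would be 0. *)
Lemma le_lattice_min_lat m (B : 'M[R]_m) M : (0 < m)%N -> row_free B ->
  (forall z, z != 0 -> M <= dotv (intv z *m B) (intv z *m B)) ->
  M <= lattice_min (lat B).
Proof.
move=> m0 fB h; apply: lb_le_inf.
  exists (dotv (intv (const_mx 1) *m B) (intv (const_mx 1) *m B)).
  exists (intv (const_mx 1) *m B) => //; split; first by exists (const_mx 1).
  apply/eqP; rewrite mulmx_free_eq0// intv_eq0; apply/eqP => /rowP/(_ (Ordinal m0)).
  by rewrite !mxE.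
move=> _ [_ [[z _ <-] /eqP v0] <-]; apply: h; apply: contraNneq v0 => ->.
by rewrite /intv raddf0 mul0mx.
Qed.

Lemma lattice_density_lat m (B : 'M[R]_m) : row_free B ->
  lattice_density (lat B) =
    (Num.sqrt (lattice_min (lat B)) / 2) ^+ m / `|\det B| * ball_vol R m.
Proof.
move=> fB; rewrite /lattice_density lattice_det_lat//; congr (_ * _).
have m0 := lattice_min_ge0 (lat B); have d0 := det_row_free fB.
rewrite -[RHS]ger0_norm; last by rewrite divr_ge0// ?exprn_ge0 ?divr_ge0 ?sqrtr_ge0.
rewrite -sqrtr_sqr; congr Num.sqrt.
rewrite !expr_div_n -[(_ ^+ m) ^+ 2]exprM mulnC exprM sqr_sqrtr// real_normK ?num_real//.
rewrite -[(2 ^+ m) ^+ 2]exprM mulnC exprM invfM mulrA; congr (_ / _ ^+ _ / _); ring.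
Qed.

(* The ellipsoids of squared radius a / 8 around the lattice points are disjoint; the
   sharper a / 4 would need open ellipsoids, and only finiteness of the bound matters. *)
Lemma lattice_density_lat_le m (B : 'M[R]_m) : row_free B ->
  lattice_density (lat B) <= Num.sqrt 2 ^+ m.
Proof.
move=> fB; rewrite lattice_density_lat//; set a := lattice_min _.
have a0 : 0 <= a := lattice_min_ge0 _; have d0 := det_row_free fB.
have [->|an] := eqVneq a 0.
  (* In dimension 0 the minimum is 0 by default and [0 ^+ 0] is 1, so the density is [ball_vol R 0],
     the volume of a point, which is 1. *)
  rewrite sqrtr0 mul0r; case: m B fB a a0 d0 => [|m] B _ _ _ _.
    have := vol_ellipsoid1 (@posdef1 R 0) => -[_]; rewrite det1 sqrtr1 divr1.
    rewrite /vol /= diracE mem_set; last by rewrite /ellipsoid /= quad0.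
    by move=> -[<-]; rewrite det_mx00 normr1 !expr0 divr1 mulr1.
  by rewrite expr0n /= !mul0r exprn_ge0// sqrtr_ge0.
have {a0} an0 : 0 < a by rewrite lt_neqAle eq_sym an.
pose F := ellipsoid (B *m B^T) (a / 8).
have := @vol_packing R m F (measurable_ellipsoid _ _).
rewrite /F vol_ellipsoid ?divr_gt0//; last exact: posdef_gram.
rewrite sqrt_det_gram lee_fin => H.
have {}H : ball_vol R m * (a / 8) `^ (m%:R / 2) / `|\det B| <= 1.
  apply: H => y z z'; rewrite /ellipsoid /= !quad_gram /aff !ofVK !scale1r => h1 h2.
  apply/eqP; rewrite -subr_eq0; apply: contraT => zz.
  (* Two vectors of squared length at most [a / 8] have a difference of squared length at most
     [a / 2], less than the minimum [a]. *)
  have := lattice_min_lat_le fB zz; rewrite -/a.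
  have := dotvB_le ((toV y + intv z) *m B) ((toV y + intv z') *m B).
  rewrite -mulmxBl opprD addrACA subrr add0r -raddfB -/(intv (z - z')) => h3 h4.
  have := le_trans h4 h3; move: h1 h2 an0; set p := dotv _ _; set q := dotv _ _.
  by clear; lra.
apply: le_trans (_ : ball_vol R m * (a / 8) `^ (m%:R / 2) / `|\det B| * Num.sqrt 2 ^+ m <= _).
  rewrite powR_half ?divr_ge0 ?(ltW an0)//.
  (* The packing radius exceeds the radius of the ellipsoids by the factor [Num.sqrt 2], whose power
     is the bound. *)
  have -> : Num.sqrt a / 2 = Num.sqrt (a / 8) * Num.sqrt 2.
    rewrite -sqrtrM ?divr_ge0 ?(ltW an0)//.
    rewrite (_ : a / 8 * 2 = a * (1 / 2) ^+ 2); last by field.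
    by rewrite sqrtrM ?(ltW an0)// sqrtr_sqr ger0_norm// div1r.
  rewrite exprMn le_eqVlt; apply/orP; left; apply/eqP; ring.
by rewrite ler_piMl// exprn_ge0// sqrtr_ge0.
Qed.

(* Without a basis, [lattice_det] is its default value 0, and division by 0 gives 0;
   so the existence of bases of arbitrary lattices is never needed. *)
Lemma lattice_density_cases m (L : set 'rV[R]_m) :
  lattice_density L = 0 \/ exists2 B, row_free B & L = lat B.
Proof.
have [[B [fB LB]]|nB] := pselect (exists B, lattice_basis L B); first by right; exists B.
left; rewrite /lattice_density /lattice_det xgetPN; last by move=> x [B LB _]; apply: nB; exists B.
by rewrite mulr0 invr0 mulr0 sqrtr0 mul0r.
Qed.

Lemma has_ubound_density m : has_ubound [set lattice_density L | L in @is_lattice R m].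
Proof.
exists (Num.sqrt 2 ^+ m) => _ [L _ <-].
have [->|[B fB ->]] := lattice_density_cases L; last exact: lattice_density_lat_le.
by rewrite exprn_ge0// sqrtr_ge0.
Qed.

Lemma lattice_density_le_max m (B : 'M[R]_m) : row_free B ->
  lattice_density (lat B) <= max_density R m.
Proof.
move=> fB; apply: ub_le_sup; first exact: has_ubound_density.
by exists (lat B) => //; exact: lat_is_lattice.
Qed.

(** The integer lattice is a witness: its nonzero vectors have squared length at least 1. *)
Lemma max_density_gt0 m : (0 < m)%N -> 0 < max_density R m.
Proof.
move=> m0; have f1 : row_free (1%:M : 'M[R]_m) by rewrite row_free_unit unitmx1.
apply: lt_le_trans (lattice_density_le_max f1); rewrite lattice_density_lat//.
have h : 1 <= lattice_min (lat (1%:M : 'M[R]_m)).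
  apply: le_lattice_min_lat => // z /rV0Pn[i zi]; rewrite mulmx1 /dotv (bigD1 i)//= -[1]addr0.
  apply: lerD; last by apply: sumr_ge0 => j _; rewrite -expr2 sqr_ge0.
  rewrite mxE -expr2 -rmorphXn /= -[1]/(1%:~R) ler_int -gtz0_ge1.
  by rewrite exprn_even_gt0.
rewrite det1 normr1 divr1 mulr_gt0 ?ball_vol_gt0// exprn_gt0// divr_gt0// sqrtr_gt0.
exact: lt_le_trans h.
Qed.

(** Because [0 <= e], a lattice denser than [e] has positive density and hence a basis. *)
Lemma max_density_adherent m e : (0 < m)%N -> 0 <= e < max_density R m ->
  exists2 B : 'M[R]_m, row_free B & e < lattice_density (lat B).
Proof.
move=> m0 /andP[e0 eD].
have S0 : [set lattice_density L | L in @is_lattice R m] !=set0.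
  exists (lattice_density (lat (1%:M : 'M[R]_m))); exists (lat 1%:M) => //.
  by apply: lat_is_lattice; rewrite row_free_unit unitmx1.
have [_ [L _ <-] eL] := sup_gt S0 eD.
have [L0|[B fB LB]] := lattice_density_cases L; last by exists B; rewrite -?LB.
by move: eL; rewrite L0 ltNge e0.
Qed.

End density.

(** * Covering the torus *)

Lemma dotv_row_mx {R : realType} m (x : R) (v : 'rV[R]_m) :
  dotv (row_mx x%:M v : 'rV[R]_(1 + m)) (row_mx x%:M v) = x ^+ 2 + dotv v v.
Proof.
rewrite /dotv big_split_ord /= big_ord1 !row_mxEl !mxE eqxx mulr1n expr2; congr (_ + _).
by apply: eq_bigr => i _; rewrite !row_mxEr.
Qed.

Section covering.
Context {R : realType} (m : nat) (B : 'M[R]_m) (M h : R).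
Hypothesis fB : row_free B.
Hypothesis h0 : 0 < h.
Hypothesis minB : forall z, z != 0 -> M <= dotv (intv z *m B) (intv z *m B).
Hypothesis dense : max_density R m.+1 <
  (Num.sqrt M / 2) ^+ m.+1 / (h * `|\det B|) * ball_vol R m.+1.

Definition short (v : 'rV[R]_m) (k : nat) (z : 'rV[int]_m) :=
  (k%:R * h) ^+ 2 + dotv ((k%:R *: v + intv z) *m B) ((k%:R *: v + intv z) *m B) < M.

(** Translates of [lat B] stacked at the heights [k h], layer [k] being shifted by [k v B]. The left
    side in [short] is the squared length of its vector with coordinates [(k, z)]. *)
Definition lamination (v : 'rV[R]_m) : 'M[R]_m.+1 :=
  block_mx h%:M (v *m B) 0 B : 'M[R]_(1 + m).

Lemma det_lamination v : \det (lamination v) = h * \det B.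
Proof. by rewrite -[in RHS](det_scalar1 h) -(det_ublock h%:M (v *m B) B). Qed.

Lemma row_free_lamination v : row_free (lamination v).
Proof.
rewrite row_free_unit unitmxE det_lamination unitfE mulf_neq0 ?(gt_eqF h0)//.
by rewrite -normr_gt0 det_row_free.
Qed.

Lemma dotv_lamination v (z : 'rV[int]_m.+1) :
  dotv (intv z *m lamination v) (intv z *m lamination v) =
  ((z 0 0)%:~R * h) ^+ 2 +
  dotv (((z 0 0)%:~R *: v + intv (rsubmx (z : 'rV[int]_(1 + m)))) *m B)
       (((z 0 0)%:~R *: v + intv (rsubmx (z : 'rV[int]_(1 + m)))) *m B).
Proof.
set w := rsubmx _; set k := (z 0 0)%:~R : R.
have -> : intv z *m lamination v = row_mx (k * h)%:M ((k *: v + intv w) *m B) :> 'rV[R]_(1 + m).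
  have zE : intv z = row_mx k%:M (intv w) :> 'rV[R]_(1 + m).
    apply/rowP => i; rewrite !mxE split1; have [j ->|->] := unliftP ord0 i.
      rewrite /= !mxE; congr (z _ _)%:~R; exact: val_inj.
    by rewrite /= mxE eqxx mulr1n.
  transitivity (row_mx k%:M (intv w) *m block_mx h%:M (v *m B) 0 B : 'rV[R]_(1 + m)).
    by rewrite -zE.
  rewrite mul_row_block mulmx0 addr0 -scalar_mxM mul_scalar_mx; congr row_mx.
  by rewrite mulmxDl -scalemxAl.
exact: dotv_row_mx.
Qed.

(** Otherwise the minimum of the lamination would be at least [M], and by [dense] its density would
    exceed the maximum. The short vector is not in layer 0, where [minB] applies; a change of sign
    makes [k] positive. *)
Lemma short_exists v : exists k z, (0 < k)%N /\ short v k z.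
Proof.
have fC := row_free_lamination v.
have [z z0 zM] : exists2 z : 'rV[int]_m.+1, z != 0 &
    dotv (intv z *m lamination v) (intv z *m lamination v) < M.
  apply: contrapT => nz.
  have : M <= lattice_min (lat (lamination v)).
    apply: le_lattice_min_lat => // z z0; rewrite leNgt; apply/negP => zM.
    by apply: nz; exists z.
  move=> Mmin; have := lt_le_trans dense (le_trans _ (lattice_density_le_max fC)).
  rewrite ltxx => H; suff : false by []. apply: H.
  rewrite lattice_density_lat// det_lamination normrM (gtr0_norm h0).
  rewrite ler_pM2r ?ball_vol_gt0// ler_pM2r ?invr_gt0 ?mulr_gt0 ?det_row_free//.
  rewrite lerXn2r ?nnegrE ?divr_ge0 ?sqrtr_ge0// ler_pM2r ?invr_gt0//.
  exact: ler_wsqrtr.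
have := zM; rewrite dotv_lamination; set w := rsubmx _; set k := z 0 0 => H.
have k0 : k != 0.
  apply: contraTneq zM => k0; rewrite -leNgt dotv_lamination -/w -/k k0 mul0r expr0n add0r.
  rewrite scale0r add0r; apply: minB; apply: contraNneq z0 => w0.
  apply/eqP/rowP => i; rewrite [RHS]mxE; have [j ->|->] := unliftP ord0 i; last exact: k0.
  have /rowP/(_ j) := w0; rewrite !mxE => <-; congr (z _ _); exact: val_inj.
have [kp|kn] := ltrP 0 k.
  exists `|k|%N, w; split; first by rewrite absz_gt0.
  by rewrite /short natr_absz (gtr0_norm kp).
have kE : (`|k|%N)%:R = - k%:~R :> R.
  by rewrite natr_absz ler0_norm// intrN.
exists `|k|%N, (- w); split; first by rewrite absz_gt0.
rewrite /short kE scaleNr /intv raddfN -opprD mulNmx mulNr sqrrN.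
have -> (u : 'rV[R]_m) : dotv (- u) (- u) = dotv u u.
  by rewrite -scaleN1r dotvZ sqrrN expr1n mul1r.
exact: H.
Qed.

Lemma short_divide v k z d (w : 'rV[int]_m) : (0 < d)%N ->
  short v (d * k) z -> z = d%:Z *: w -> short v k w.
Proof.
move=> d0 + zE; rewrite /short zE natrM.
have -> : (d%:R * k%:R) *: v + intv (d%:Z *: w) = d%:R *: (k%:R *: v + intv w) :> 'rV[R]_m.
  rewrite scalerDr scalerA; congr (_ + _); apply/rowP => i.
  by rewrite !mxE intrM.
rewrite -scalemxAl dotvZ -mulrA exprMn -mulrDr; apply: le_lt_trans.
rewrite ler_peMl ?addr_ge0 ?sqr_ge0 ?dotv_ge0// exprn_ege1// ler1n//.
Qed.

Definition residue k (z : {ffun 'I_m -> 'I_k}) : 'rV[int]_m := \row_i (z i : nat)%:Z.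

(** Take the least possible [k] and reduce [z] modulo [k]. A prime dividing [k] and all residues
    would divide [z] too, and [short_divide] would produce a smaller [k]. *)
Lemma short_primitive v : exists k (z : {ffun 'I_m -> 'I_k}) q,
  [/\ (0 < k)%N, primitive_mod z & short v k (residue z + k%:Z *: q)].
Proof.
pose P k := `[< (0 < k)%N /\ exists z, short v k z >].
have exP : exists k, P k.
  by have [k [z [k0 s]]] := short_exists v; exists k; apply/asboolP; split => //; exists z.
case: (ex_minnP exP) => k /asboolP[k0 [z sz]] kmin.
have lt_mod i : (`|(z 0%R i %% k%:Z)%Z|%N < k)%N.
  by rewrite -ltz_nat gez0_abs ?modz_ge0 ?ltz_pmod// -lt0n.
exists k, [ffun i => Ordinal (lt_mod i)], (\row_i (z 0%R i %/ k%:Z)%Z).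
have zE : residue [ffun i => Ordinal (lt_mod i)] + k%:Z *: \row_i (z 0%R i %/ k%:Z)%Z = z.
  apply/rowP => i; rewrite !mxE ffunE /= gez0_abs ?modz_ge0 -?lt0n//.
  by rewrite addrC mulrC -divz_eq.
rewrite zE; split => //; apply/hasPn => p; rewrite mem_primes => /and3P[pp _ pk].
apply/negP => /forallP pz.
have [j kE] := dvdnP pk.
have pz' i : (p%:Z %| z 0%R i)%Z.
  rewrite (divz_eq (z 0 i) k%:Z) rpredD ?dvdz_mull//.
  have := pz i; rewrite ffunE /= => h1; rewrite -[X in (_ %| X)%Z]gez0_abs// modz_ge0//.
  by rewrite eqz_nat -lt0n.
have j0 : (0 < j)%N by move: k0; rewrite kE muln_gt0 => /andP[].
have : (k <= j)%N.
  apply: kmin; apply/asboolP; split => //; exists (\row_i (z 0%R i %/ p%:Z)%Z).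
  apply: (@short_divide v j z p _ (prime_gt0 pp)).
    by rewrite mulnC -kE.
  by apply/rowP => i; rewrite !mxE mulrC divzK.
by rewrite kE leqNgt ltn_Pmulr// prime_gt1.
Qed.

(** The torus is covered by the sets [A (k, z)] of those [y] with [k y + z] in the ellipsoid left
    over at height [k h]. Each has the volume of this ellipsoid divided by [k ^ m], and counting the
    primitive [z] gives the Möbius factor. *)
Lemma covering_bound N : (forall k, (0 < k)%N -> ((k%:R * h) ^+ 2 < M) = (k <= N)%N) ->
  1 <= \sum_(1 <= k < N.+1) (\sum_(l <- divisors k) (mobius l)%:~R / l%:R ^+ m) *
     (ball_vol R m * (M - (k%:R * h) ^+ 2) `^ (m%:R / 2) / `|\det B|).
Proof.
move=> NP; pose G := B *m B^T; have pG : posdef G := posdef_gram fB.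
pose E (k : nat) := ellipsoid G (M - (k%:R * h) ^+ 2).
pose A (i : nat * 'rV[int]_m) : set (euclid m) := aff i.1%:R (intv i.2) @^-1` E i.1.
pose s := [seq (k, residue z) | k <- index_iota 1 N.+1,
                                z <- enum [pred z : {ffun 'I_m -> 'I_k} | primitive_mod z]].
have mA i : measurable (A i) by apply: measurable_aff_preimage; exact: measurable_ellipsoid.
have := @vol_covering R m _ s A mA.
have -> : (\sum_(i <- s) vol m (A i) = (\sum_(1 <= k < N.+1)
    (\sum_(l <- divisors k) (mobius l)%:~R / l%:R ^+ m) *
     (ball_vol R m * (M - (k%:R * h) ^+ 2) `^ (m%:R / 2) / `|\det B|))%:E)%E.
  rewrite /s big_allpairs_dep -sumEFin big_seq [RHS]big_seq; apply: eq_bigr => k.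
  rewrite mem_index_iota ltnS => /andP[k0 kN].
  have kR : 0 < k%:R :> R by rewrite ltr0n.
  have kh : 0 < M - (k%:R * h) ^+ 2 by rewrite subr_gt0 NP.
  have volA z : vol m (A (k, z)) =
    ((ball_vol R m * (M - (k%:R * h) ^+ 2) `^ (m%:R / 2) / `|\det B|) / k%:R ^+ m)%:E.
    have /= := vol_aff (intv z) kR (measurable_ellipsoid G (M - (k%:R * h) ^+ 2)).
    rewrite vol_ellipsoid// sqrt_det_gram => /(congr1 (fun x => (k%:R ^- m)%:E * x)%E).
    rewrite -EFinM muleA -EFinM mulVf ?expf_neq0 ?gt_eqF// mul1e => <-.
    by rewrite mulrC.
  under eq_bigr do rewrite volA.
  rewrite sumEFin big_const_seq count_predT iter_addr_0 -cardE; congr EFin.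
  by rewrite -card_primitive_mod// -mulr_natl; ring.
rewrite lee_fin; apply => y cy.
have [k [z [q [k0 pz sz]]]] := short_primitive (toV y).
exists (k, residue z).
  apply/allpairsPdep; exists k, z; split => //; last by rewrite mem_enum.
  rewrite mem_index_iota k0 ltnS -NP//; apply: le_lt_trans sz.
  by rewrite lerDl dotv_ge0.
(* Moving [y] by the integer vector [q] changes [k y + z] by [k q], so one residue stands for its
   whole class modulo [k]. *)
exists q; rewrite /A /E /ellipsoid /= quad_gram affK mulr1 /aff ofVK.
move: sz; rewrite /short -ltrBrDl => /ltW; congr (_ <= _).
have -> : intv (residue z + k%:Z *: q) = k%:R *: intv q + intv (residue z) :> 'rV[R]_m.
  by apply/rowP => i; rewrite !mxE intrD intrM addrC.
by [].
Qed.

End covering.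

(** * Passage to the limit *)

Section center_density.
Context {R : realType} (m : nat) (m0 : (0 < m)%N).

Notation c k := (\sum_(l <- divisors k) (mobius l)%:~R / l%:R ^+ m : R).

(** The critical layer height in units of the shortest vector of [B]: over a densest [B], a
    lamination of this height with the same minimum would have exactly the maximal density. *)
Definition density_ratio : R := center_density R m / (2 * center_density R m.+1).

Lemma center_density_gt0 d : (0 < d)%N -> 0 < center_density R d.
Proof. by move=> d0; rewrite divr_gt0 ?max_density_gt0 ?ball_vol_gt0. Qed.

Lemma ratio_gt0 : 0 < density_ratio.
Proof. by apply: divr_gt0; [|apply: mulr_gt0 => //]; exact: center_density_gt0. Qed.

Lemma max_densityE d : max_density R d = center_density R d * ball_vol R d.
Proof. by rewrite divfK// gt_eqF// ball_vol_gt0. Qed.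

Lemma lt_ratio_mul (x y V t : R) : 0 < V -> 0 < y -> t < x / (2 * y) ->
  2 * V * y * t < x * V.
Proof.
move=> V0 y0; rewrite ltr_pdivlMr ?mulr_gt0// => h.
by rewrite (_ : _ * t = t * (2 * y) * V); [rewrite ltr_pM2r|ring].
Qed.

Lemma lt_mul_ratio (s d t V y : R) : 0 < s -> 0 < d -> 0 < t -> 0 < V ->
  2 * V * y * t < (s / 2) ^+ m / d * V -> y < (s / 2) ^+ m.+1 / (s * t * d).
Proof.
move=> s0 d0 t0 V0 h.
rewrite (_ : _ / _ = (s / 2) ^+ m / d * V / (2 * V * t)).
  by rewrite ltr_pdivlMr ?mulr_gt0// (_ : y * _ = 2 * V * y * t)//; ring.
by rewrite exprS; field; rewrite !gt_eqF.
Qed.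

(** The covering bound for layer height [t] times the shortest length [Num.sqrt a]. As [t] is below
    the critical ratio, some [B] has density large enough to satisfy [dense] at this height. *)
Lemma covering_sum t N : 0 < t < density_ratio ->
  (forall k, (0 < k)%N -> (k%:R * t < 1) = (k <= N)%N) ->
  1 <= 2 ^+ m * max_density R m *
    \sum_(1 <= k < N.+1) c k * Num.sqrt (1 - (k%:R * t) ^+ 2) ^+ m.
Proof.
move=> /andP[t0 tr] NP.
have Vm := @ball_vol_gt0 R m; have Vn := @ball_vol_gt0 R m.+1.
have dn := @center_density_gt0 m.+1 isT; have dm := center_density_gt0 m0.
have e0 : 0 <= 2 * ball_vol R m * center_density R m.+1 * t :=
  mulr_ge0 (mulr_ge0 (mulr_ge0 (ler0n _ 2) (ltW Vm)) (ltW dn)) (ltW t0).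
have [|B fB lt_rho] := @max_density_adherent R m (2 * ball_vol R m * center_density R m.+1 * t) m0.
  apply/andP; split; first exact: e0.
  rewrite max_densityE; exact: lt_ratio_mul.
rewrite lattice_density_lat// in lt_rho; set a := lattice_min _ in lt_rho.
have d0 := det_row_free fB.
set rho := (_ * _ in X in _ < X) in lt_rho.
have rho0 : 0 < rho by exact: le_lt_trans lt_rho.
have a0 : 0 < a.
  rewrite lt_neqAle eq_sym lattice_min_ge0 andbT; apply: contraTneq rho0 => a0.
  by rewrite /rho a0 sqrtr0 mul0r expr0n -leqn0 leqNgt m0 /= !mul0r ltxx.
have sa0 : 0 < Num.sqrt a by rewrite sqrtr_gt0.
have rhomax : rho <= max_density R m.
  by rewrite /rho -lattice_density_lat//; exact: lattice_density_le_max.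
have dense : max_density R m.+1 <
    (Num.sqrt a / 2) ^+ m.+1 / (Num.sqrt a * t * `|\det B|) * ball_vol R m.+1.
  by rewrite max_densityE ltr_pM2r//; exact: lt_mul_ratio lt_rho.
have kaE k : (k%:R * (Num.sqrt a * t)) ^+ 2 = a * (k%:R * t) ^+ 2.
  by rewrite mulrCA exprMn sqr_sqrtr// ltW.
have NP' k : (0 < k)%N -> ((k%:R * (Num.sqrt a * t)) ^+ 2 < a) = (k <= N)%N.
  move=> k0; rewrite kaE -[X in _ < X]mulr1 ltr_pM2l// -NP//.
  by rewrite expr_lt1// mulr_ge0// ltW.
have := covering_bound fB (mulr_gt0 sa0 t0)
  (fun z z0 => lattice_min_lat_le fB z0) dense NP'.
set S := \sum_(1 <= k < N.+1) c k * Num.sqrt (1 - (k%:R * t) ^+ 2) ^+ m.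
have -> : \sum_(1 <= k < N.+1) c k * (ball_vol R m *
    (a - (k%:R * (Num.sqrt a * t)) ^+ 2) `^ (m%:R / 2) / `|\det B|) = 2 ^+ m * rho * S.
  rewrite /S mulr_sumr; apply: eq_big_nat => k /andP[k0 kN].
  have kt : 0 <= 1 - (k%:R * t) ^+ 2.
    by rewrite subr_ge0 expr_le1 ?mulr_ge0 ?(ltW t0)// ltW// NP.
  rewrite kaE -{1}[a]mulr1 -mulrBr powR_half ?mulr_ge0 ?(ltW a0)// sqrtrM ?(ltW a0)//.
  rewrite exprMn /rho expr_div_n; field.
  by rewrite gt_eqF// expf_neq0.
move=> H; have p : 0 < 2 ^+ m * rho * S := lt_le_trans ltr01 H.
(* Positivity of the sum is read off the bound itself; it allows [rho] to be raised to the maximal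
   density. *)
have S0 : 0 < S by move: p; rewrite pmulr_rgt0// mulr_gt0// exprn_gt0.
by apply: le_trans H _; rewrite ler_pM2r// ler_pM2l// exprn_gt0.
Qed.

Lemma truncn_ratio k : (0 < k)%N ->
  (k < (Num.truncn density_ratio^-1).+1)%N = (k%:R * density_ratio <= 1).
Proof.
move=> k0; have r0 := ratio_gt0.
by rewrite ltnS truncn_ge_nat ?invr_ge0 ?(ltW r0)// -ler_pdivlMr// div1r.
Qed.

(** Natural powers of [Num.sqrt] are continuous even where [1 - (k t) ^ 2] vanishes, which can
    happen in the limit. *)
Lemma continuous_covering_sum (C : R) (N : nat) :
  continuous (fun t : R => C * \sum_(1 <= k < N) c k * Num.sqrt (1 - (k%:R * t) ^+ 2) ^+ m).
Proof.
have cs k : continuous (fun t : R => c k * Num.sqrt (1 - (k%:R * t) ^+ 2) ^+ m).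
  move=> t; apply: (@continuousM _ _ (fun=> c k)
      (fun t : R => Num.sqrt (1 - (k%:R * t) ^+ 2) ^+ m)).
    exact: cst_continuous.
  apply: (@continuous_comp _ _ _ (fun t : R => Num.sqrt (1 - (k%:R * t) ^+ 2)) (fun x => x ^+ m)).
    apply: (@continuous_comp _ _ _ (fun t : R => 1 - (k%:R * t) ^+ 2) Num.sqrt).
      apply: continuousB; first exact: cst_continuous.
      apply: (@continuous_comp _ _ _ (fun t : R => k%:R * t) (fun x => x ^+ 2)).
        by apply: continuousM; [exact: cst_continuous|exact: cvg_id].
      exact: exprn_continuous.
    exact: sqrt_continuous.
  exact: exprn_continuous.
move=> t; apply: continuousM; first exact: cst_continuous.
exact: (continuous_sum cs).
Qed.

Lemma center_density_sum :
  1 <= 2 ^+ m * max_density R m *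
    \sum_(1 <= k < (Num.truncn density_ratio^-1).+1)
      c k * (1 - (k%:R * density_ratio) ^+ 2) `^ (m%:R / 2).
Proof.
have r0 := ratio_gt0; set N := Num.truncn _.
have -> : \sum_(1 <= k < N.+1) c k * (1 - (k%:R * density_ratio) ^+ 2) `^ (m%:R / 2) =
          \sum_(1 <= k < N.+1) c k * Num.sqrt (1 - (k%:R * density_ratio) ^+ 2) ^+ m.
  apply: eq_big_nat => k /andP[k0]; rewrite /N truncn_ratio// => kr.
  by rewrite powR_half// subr_ge0 expr_le1// mulr_ge0// ltW.
set C := 2 ^+ m * _.
pose f (t : R) := C * \sum_(1 <= k < N.+1) c k * Num.sqrt (1 - (k%:R * t) ^+ 2) ^+ m.
rewrite -[leRHS]/(f density_ratio) leNgt; apply/negP => f1.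
(* For [t] strictly between [1 / N.+1] and the ratio, [k t < 1] holds exactly when [k <= N], so the
   number of terms stays constant as [t] increases to the ratio. *)
have Nr : N.+1%:R^-1 < density_ratio.
  by rewrite invf_plt ?posrE// ?ltr0n// truncnS_gt.
have fl : f t @[t --> density_ratio^'-] --> f density_ratio.
  by apply: cvg_at_left_filter; exact: continuous_covering_sum.
have : \forall t \near density_ratio^'-, [/\ f t < 1, t < density_ratio & N.+1%:R^-1 < t].
  near=> t; split.
  - by near: t; exact: cvgr_lt fl _ f1.
  - by near: t; exact: nbhs_left_lt.
  - by near: t; exact: nbhs_left_gt.
move=> H; have [t [ft tr Nt]] := @filter_ex _ _ (at_left_proper_filter density_ratio) _ H.
have t0 : 0 < t by apply: lt_trans Nt; rewrite invr_gt0 ltr0n.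
move: ft; rewrite ltNge => /negP; apply; apply: covering_sum; first by rewrite t0.
move=> k k0; apply/idP/idP => [kt|kN].
  rewrite leqNgt; apply/negP => Nk.
  suff : 1 < k%:R * t by rewrite ltNge ltW.
  apply: (@lt_le_trans _ _ (N.+1%:R * t)); first by rewrite mulrC -ltr_pdivrMr ?ltr0n// div1r.
  by rewrite ler_pM2r// ler_nat.
have : k%:R * density_ratio <= 1 by rewrite -truncn_ratio.
by apply: lt_le_trans; rewrite ltr_pM2l// ltr0n.
Unshelve. all: by end_near.
Qed.

End center_density.

(** * The three equivalent forms of the inequality *)

Section hermite.
Context {R : realType}.

Lemma hermite_const_gt0 d : (0 < d)%N -> 0 < hermite_const R d.
Proof. by move=> d0; rewrite mulr_gt0// powR_gt0// center_density_gt0. Qed.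

Lemma hermite_const_powR d : (0 < d)%N ->
  hermite_const R d `^ (d%:R / 2) = 2 ^+ d * center_density R d.
Proof.
move=> d0; have c0 := @center_density_gt0 R d d0.
have dn0 : d%:R != 0 :> R by rewrite pnatr_eq0 -lt0n.
rewrite /hermite_const powRM ?powR_ge0// -powRrM powR_half//; congr (_ * _).
  by rewrite (_ : 4 = 2 ^+ 2) ?sqrtr_sqr ?ger0_norm// -natrX.
by rewrite (_ : 2 / d%:R * (d%:R / 2) = 1) ?powRr1 ?(ltW c0)//; field.
Qed.

Lemma hermite_const_expn d : (0 < d)%N ->
  hermite_const R d ^+ d = (2 ^+ d * center_density R d) ^+ 2.
Proof.
move=> d0; rewrite -hermite_const_powR// powR_half ?(ltW (hermite_const_gt0 d0))//.
by rewrite -exprM mulnC exprM sqr_sqrtr// ltW// hermite_const_gt0.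
Qed.

(** All three forms are rewritings of one inequality in the ratio [r]; abstract numbers keep the
    algebra within reach of [field]. *)
Lemma equivalent_forms (c : nat -> R) m (Dm Dn Vm Vn dm dn gm gn : R) :
  let r := dm / (2 * dn) in
  0 < Vm -> 0 < Vn -> 0 < dm -> 0 < dn -> 0 < gm ->
  Dm = dm * Vm -> Dn = dn * Vn ->
  gm `^ (m%:R / 2) = 2 ^+ m * dm -> gn `^ (m.+1%:R / 2) = 2 ^+ m.+1 * dn ->
  gm ^+ m = (2 ^+ m * dm) ^+ 2 -> gn ^+ m.+1 = (2 ^+ m.+1 * dn) ^+ 2 ->
  1 <= 2 ^+ m * Dm *
    \sum_(1 <= k < (Num.truncn r^-1).+1) c k * (1 - (k%:R * r) ^+ 2) `^ (m%:R / 2) ->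
  [/\ 2 ^+ m * Dm *
        (\sum_(1 <= k < (Num.truncn (2 * Dn * Vm / (Dm * Vn))).+1)
            c k * (1 - (k%:R * Dm * Vn / (2 * Dn * Vm)) ^+ 2) `^ (m%:R / 2)) >= 1,
      2 ^+ m * dm * Vm *
        (\sum_(1 <= k < (Num.truncn (2 * dn / dm)).+1)
            c k * (1 - (k%:R * dm / (2 * dn)) ^+ 2) `^ (m%:R / 2)) >= 1
    & Vm *
        (\sum_(1 <= k < (Num.truncn (gn `^ (m.+1%:R / 2) / gm `^ (m%:R / 2))).+1)
            c k * (gm - k%:R ^+ 2 * (gm / gn) ^+ m.+1) `^ (m%:R / 2)) >= 1].
Proof.
move=> r Vm0 Vn0 dm0 dn0 gm0 DmE DnE pm pn em en main.
have r0 : 0 < r by rewrite divr_gt0// mulr_gt0.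
have rD : Dm * Vn / (2 * Dn * Vm) = r by rewrite DmE DnE /r; field; rewrite !gt_eqF.
have rV : r^-1 = 2 * dn / dm by rewrite /r invf_div.
split.
- rewrite -[2 * Dn * Vm / _]invf_div rD.
  by under eq_bigr do rewrite -2!mulrA [Dm * _]mulrA rD.
- rewrite -rV -[2 ^+ m * dm * Vm]mulrA -DmE.
  by under eq_bigr do rewrite -mulrA.
- have -> : gn `^ (m.+1%:R / 2) / gm `^ (m%:R / 2) = r^-1.
    by rewrite pm pn rV exprS; field; rewrite expf_neq0// gt_eqF.
  apply: le_trans main _; rewrite le_eqVlt; apply/orP; left; apply/eqP.
  rewrite DmE mulrA [_ * Vm]mulrC -mulrA; congr (_ * _).
  rewrite mulr_sumr; apply: eq_big_nat => k /andP[k0].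
  rewrite ltnS truncn_ge_nat ?invr_ge0 ?(ltW r0)// -[r^-1]mul1r ler_pdivlMr// => kr.
  (* The factor [2 ^+ m * dm] is a power of [gm] and moves into the base, which is nonnegative
     because [k r <= 1]. *)
  rewrite mulrCA -pm -powRM ?(ltW gm0)//; last first.
    by rewrite subr_ge0 expr_le1// mulr_ge0// ltW.
  congr (_ * _ `^ _); rewrite mulrBr mulr1; congr (_ - _).
  rewrite exprMn mulrCA; congr (_ * _).
  (* This is the identity [gm * r ^+ 2 = (gm / gn) ^+ m.+1]. *)
  rewrite [(gm / gn) ^+ _]expr_div_n en [gm ^+ _]exprS em /r [2 ^+ m.+1]exprS; field.
  by rewrite expf_neq0// gt_eqF.
Qed.

End hermite.

Theorem theorem1 (R : realType) (n : nat) (hn : (2 <= n)%N) :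
  let V := @ball_vol R in
  let Delta := @max_density R in
  let delta := @center_density R in
  let gamma := @hermite_const R in
  [/\ 2 ^+ n.-1 * Delta n.-1 *
        (\sum_(1 <= k < (Num.truncn (2 * Delta n * V n.-1 /
                                       (Delta n.-1 * V n))).+1)
            (\sum_(l <- divisors k) (mobius l)%:~R / l%:R ^+ n.-1) *
            (1 - (k%:R * Delta n.-1 * V n / (2 * Delta n * V n.-1)) ^+ 2)
              `^ (n.-1%:R / 2)) >= 1,
      2 ^+ n.-1 * delta n.-1 *
        (pi `^ (n.-1%:R / 2) / real_fact (n.-1%:R / 2)) *
        (\sum_(1 <= k < (Num.truncn (2 * delta n / delta n.-1)).+1)
            (\sum_(l <- divisors k) (mobius l)%:~R / l%:R ^+ n.-1) *
            (1 - (k%:R * delta n.-1 / (2 * delta n)) ^+ 2)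
              `^ (n.-1%:R / 2)) >= 1
    & (pi `^ (n.-1%:R / 2) / real_fact (n.-1%:R / 2)) *
        (\sum_(1 <= k < (Num.truncn (gamma n `^ (n%:R / 2) /
                                       gamma n.-1 `^ (n.-1%:R / 2))).+1)
            (\sum_(l <- divisors k) (mobius l)%:~R / l%:R ^+ n.-1) *
            (gamma n.-1 - k%:R ^+ 2 * (gamma n.-1 / gamma n) ^+ n)
              `^ (n.-1%:R / 2)) >= 1].
Proof.
case: n hn => [//|m] m0; have {}m0 : (0 < m)%N by [].
exact: (equivalent_forms (@ball_vol_gt0 R m) (@ball_vol_gt0 R m.+1)
  (@center_density_gt0 R m m0) (@center_density_gt0 R m.+1 isT)
  (@hermite_const_gt0 R m m0) (@max_densityE R m) (@max_densityE R m.+1)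
  (@hermite_const_powR R m m0) (@hermite_const_powR R m.+1 isT)
  (@hermite_const_expn R m m0) (@hermite_const_expn R m.+1 isT)
  (@center_density_sum R m m0)).
Qed.
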